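(* Let $G=(V,E,w)$ be a directed graph on $n$ vertices with edge weights $w:E\to\mathbb{R}_+$ and let $\pi:V\to\mathbb{R}_+$ be vertex weights. Then $$\lambda^{\triangle}_\pi(G)\lesssim \vec{\phi}_\pi(G)\lesssim \sqrt{\log n}\cdot \lambda^{\triangle}_\pi(G).$$
   Context: For $S\subseteq V$, $\delta^+(S)=\{ij\in E: i\in S, j\notin S\}$, $\delta^-(S)=\delta^+(\overline S)$, $\pi(S)=\sum_{i\in S}\pi(i)$, $w(A)=\sum_{e\in A}w(e)$. The $\pi$-weighted directed edge expansion is $\vec{\phi}_\pi(S)=\frac{\min\{w(\delta^+(S)),w(\delta^-(S))\}}{\min\{\pi(S),\pi(\overline S)\}}$ and $\vec\phi_\pi(G)=\min_{\emptyset\ne S\subsetneq V}\vec\phi_\pi(S)$. Let $\mathcal F(G)$ be the set of functions $F:E\to\mathbb{R}_{\ge0}$ with $\sum_{j:ij\in E}F(i,j)=\sum_{j:ji\in E}F(j,i)$ for all $i\in V$ and $F(e)\le w(e)$ for all $e\in E$ (with the convention $F(i,j)=0$ if $ij\notin E$). Define $$\lambda^{\triangle}_\pi(G)=\min_{v_1,\dots,v_n\in\mathbb{R}^n}\ \max_{F\in\mathcal F(G)}\ \sum_{i<j}\tfrac12\big(F(i,j)+F(j,i)\big)\|v_i-v_j\|^2$$ where the minimum is over vectors satisfying $\sum_i\pi(i)v_i=0$, $\sum_i\pi(i)\|v_i\|^2=1$, and $\|v_i-v_k\|^2+\|v_k-v_j\|^2\ge\|v_i-v_j\|^2$ for all $i,j,k\in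 V$. The notation $f\lesssim g$ means $f\le c\,g$ for an absolute constant $c>0$. *)

(* Defs.v *)
From mathcomp Require Import all_boot all_order all_algebra.
From mathcomp Require Import all_classical all_reals all_analysis.
Set Implicit Arguments. Unset Strict Implicit. Unset Printing Implicit Defensive.
Import Order.TTheory GRing.Theory Num.Theory.
Local Open Scope ring_scope.
Local Open Scope classical_set_scope.

Section Defs.
Variable R : realType.
Variable n : nat.

Definition sqn (x : 'rV[R]_n) : R := \sum_(k < n) x ord0 k ^+ 2.

Definition wout (E : rel 'I_n) (w : 'I_n -> 'I_n -> R) (S : {set 'I_n}) : R :=
  \sum_(i in S) \sum_(j in ~: S | E i j) w i j.

Definition piS (pi : 'I_n -> R) (S : {set 'I_n}) : R := \sum_(i in S) pi i.

Definition dir_exp_set (E : rel 'I_n) (w : 'I_n -> 'I_n -> R) (pi : 'I_n -> R)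
  (S : {set 'I_n}) : R :=
  Num.min (wout E w S) (wout E w (~: S)) / Num.min (piS pi S) (piS pi (~: S)).

Definition dir_exp (E : rel 'I_n) (w : 'I_n -> 'I_n -> R) (pi : 'I_n -> R) : R :=
  inf [set x | exists S : {set 'I_n},
         [/\ S != finset.set0, S != [set: 'I_n]%SET & x = dir_exp_set E w pi S]].

Definition is_circ (E : rel 'I_n) (w : 'I_n -> 'I_n -> R) (F : 'I_n -> 'I_n -> R) :=
  [/\ forall i j, 0 <= F i j,
      forall i j, ~~ E i j -> F i j = 0,
      forall i j, E i j -> F i j <= w i j
    & forall i, \sum_(j < n) F i j = \sum_(j < n) F j i].

Definition feasible (pi : 'I_n -> R) (v : 'I_n -> 'rV[R]_n) :=
  [/\ \sum_(i < n) pi i *: v i = 0,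
      \sum_(i < n) pi i * sqn (v i) = 1
    & forall i j k, sqn (v i - v j) <= sqn (v i - v k) + sqn (v k - v j)].

Definition energy (F : 'I_n -> 'I_n -> R) (v : 'I_n -> 'rV[R]_n) : R :=
  \sum_(i < n) \sum_(j < n | (i < j)%N) 2^-1 * (F i j + F j i) * sqn (v i - v j).

Definition lam_tri (E : rel 'I_n) (w : 'I_n -> 'I_n -> R) (pi : 'I_n -> R) : R :=
  inf [set x | exists v : 'I_n -> 'rV[R]_n, feasible pi v /\
         x = sup [set y | exists F, is_circ E w F /\ y = energy F v]].

End Defs.

(* Main.v *)
Require Import Defs.
From mathcomp Require Import all_boot all_order all_algebra.
From mathcomp Require Import all_classical all_reals all_analysis.
From mathcomp Require Import ring lra.
Set Implicit Arguments.
Unset Strict Implicit.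
Unset Printing Implicit Defensive.
Import Order.TTheory GRing.Theory Num.Theory.
Import numFieldNormedType.Exports.
Local Open Scope ring_scope.

(** The lower bound on the expansion is witnessed by two-valued vectors [v]:
    a circulation crosses a cut equally often in both directions.

    For the upper bound, LP duality for circulations turns the inner maximum
    into [min_r \sum_(i, j) w i j * max 0 (d i j - r i + r j)], where
    [d i j = ||v i - v j||^2]. For a set [A] the potential
    [x j = min_(a in A) (d a j - r a + r j)] grows along an edge [(i, j)] by at
    most [d i j - r i + r j], so some level set of [x] has small outgoing
    weight compared with [\sum_j pi j * max 0 (x j)]. Splitting at a median of
    [r] makes this sum large in two situations: a ball of constant radius has
    constant measure, or there are two sets of constant measure at distance
    [Omega (1 / sqrt (log n))].

    In the remaining well-spread case such sets exist (Arora-Rao-Vazirani).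
    Otherwise, for a random sign vector [u], there is a fractional matching
    [m_u] of constant mass between points [i, j] with [d i j <= Delta] and
    [<v j - v i, u> >= sigma]. Let
    [f_k i u = max {<v j - v i, u> | d i j <= k Delta}] and [G_k i = E f_k i].
    On matched pairs [f_(k+1) i u >= sigma + f_k j u], and symmetrically for
    [- u]. As [f_k i] has variance [O(k Delta)] (Efron-Stein), replacing
    [f_k] by [G_k] costs little while [k Delta] is below a small constant, and
    the sum over [k < K] telescopes to [K sigma <= O(max_i G_K i)], which is
    [O(sqrt (K Delta log n))]; this fails for [K] of order [sqrt (log n)]. *)

(** * Rademacher averages *)

Section Rademacher.
Variable R : realType.
Implicit Types (N : nat) (x u : nat -> R) (F G : (nat -> R) -> R).

Definition scons (e : R) u : nat -> R := fun k => if k is k'.+1 then u k' else e.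

(* [Ex N F] averages [F] over the [2 ^ N] sign vectors [u 0, ..., u N.-1]; the
   remaining coordinates of [u] are [0]. *)
Fixpoint Ex N F : R :=
  if N is N'.+1 then
    2^-1 * (Ex N' (fun u => F (scons 1 u)) + Ex N' (fun u => F (scons (-1) u)))
  else F (fun=> 0).

Definition ip N x u : R := \sum_(k < N) x k * u k.

Definition nsq N x : R := \sum_(k < N) x k ^+ 2.

Lemma eq_Ex N F G : F =1 G -> Ex N F = Ex N G.
Proof. by move=> /funext ->. Qed.

Lemma ExD N F G : Ex N (fun u => F u + G u) = Ex N F + Ex N G.
Proof. by elim: N F G => [|N IH] F G //=; rewrite !IH; lra. Qed.

Lemma ExZ N a F : Ex N (fun u => a * F u) = a * Ex N F.
Proof. by elim: N F => [|N IH] F //=; rewrite !IH; ring. Qed.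

Lemma Ex_cst N a : Ex N (fun=> a) = a.
Proof. by elim: N => [|N IH] //=; rewrite !IH; field. Qed.

Lemma ExB N F G : Ex N (fun u => F u - G u) = Ex N F - Ex N G.
Proof.
rewrite -[X in _ - X]mul1r -mulNr -ExZ -ExD.
by apply: eq_Ex => u; rewrite mulN1r.
Qed.

Lemma Ex_sum N (I : Type) (s : seq I) (P : pred I) (f : I -> (nat -> R) -> R) :
  Ex N (fun u => \sum_(i <- s | P i) f i u) = \sum_(i <- s | P i) Ex N (f i).
Proof.
elim: s => [|i s IH].
  by rewrite big_nil -[RHS](Ex_cst N); apply: eq_Ex => u; rewrite big_nil.
rewrite big_cons -IH.
case Pi: (P i); last by apply: eq_Ex => u; rewrite big_cons Pi.
by rewrite -ExD; apply: eq_Ex => u; rewrite big_cons Pi.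
Qed.

Lemma le_Ex N F G : (forall u, F u <= G u) -> Ex N F <= Ex N G.
Proof.
elim: N F G => [|N IH] F G FG //=.
by rewrite ler_pM2l ?invr_gt0// lerD// IH.
Qed.

Lemma ExN N F : Ex N (fun u => F (fun k => - u k)) = Ex N F.
Proof.
elim: N F => [|N IH] F /=; first by congr F; apply/funext => k; rewrite oppr0.
rewrite addrC; congr (_ * (_ + _)).
- rewrite -[RHS]IH; apply: eq_Ex => u; congr F.
  by apply/funext => -[|k] //=; rewrite opprK.
- by rewrite -[RHS]IH; apply: eq_Ex => u; congr F; apply/funext => -[|k].
Qed.

Lemma ip_scons N x e u :
  ip N.+1 x (scons e u) = x 0 * e + ip N (fun k => x k.+1) u.
Proof. by rewrite /ip big_ord_recl. Qed.

Lemma nsqS N x : nsq N.+1 x = x 0 ^+ 2 + nsq N (fun k => x k.+1).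
Proof. by rewrite /nsq big_ord_recl. Qed.

Lemma nsq_ge0 N x : 0 <= nsq N x.
Proof. by apply: sumr_ge0 => k _; exact: sqr_ge0. Qed.

Lemma ipBr N x u v : ip N x (fun k => u k - v k) = ip N x u - ip N x v.
Proof. by rewrite /ip -sumrB; apply: eq_bigr => k _; rewrite mulrBr. Qed.

Lemma ipBl N x y u : ip N (fun k => x k - y k) u = ip N x u - ip N y u.
Proof. by rewrite /ip -sumrB; apply: eq_bigr => k _; rewrite mulrBl. Qed.

Lemma ipNr N x u : ip N x (fun k => - u k) = - ip N x u.
Proof. by rewrite /ip -sumrN; apply: eq_bigr => k _; rewrite mulrN. Qed.

Lemma ipZl N a x u : ip N (fun k => a * x k) u = a * ip N x u.
Proof. by rewrite /ip mulr_sumr; apply: eq_bigr => k _; rewrite mulrA. Qed.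

Lemma nsqZ N a x : nsq N (fun k => a * x k) = a ^+ 2 * nsq N x.
Proof. by rewrite /nsq mulr_sumr; apply: eq_bigr => k _; rewrite exprMn. Qed.

(** * Exponential and low moments of sign sums *)

Lemma expR_le_inv (t : R) : t < 1 -> expR t <= (1 - t)^-1.
Proof.
move=> t1; rewrite -[expR t]invrK lef_pV2 ?posrE ?invr_gt0 ?expR_gt0 ?subr_gt0//.
by rewrite -expRN; have := expR_ge1Dx (- t).
Qed.

Lemma expR_le_quad (t : R) : `|t| <= 2^-1 -> expR t <= 1 + t + 2 * t ^+ 2.
Proof.
rewrite ler_norml => /andP[t1 t2].
apply: le_trans (expR_le_inv _) _; first by lra.
rewrite -[leLHS]mul1r ler_pdivrMr; last by lra.
have : 0 <= t ^+ 2 * (1 - 2 * t) by rewrite mulr_ge0 ?sqr_ge0//; lra.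
rewrite (_ : (1 + t + 2 * t ^+ 2) * (1 - t) = 1 + t ^+ 2 * (1 - 2 * t)); first lra.
by ring.
Qed.

(** For [|t| <= 1/2] the linear terms of the two quadratic bounds cancel; beyond that,
    [|t| <= 2 t^2] bounds each exponential separately. *)
Lemma cosh_le (t : R) : 2^-1 * (expR t + expR (- t)) <= expR (2 * t ^+ 2).
Proof.
have [t2|t2] := lerP `|t| 2^-1.
  apply: le_trans (expR_ge1Dx _).
  have := expR_le_quad t2; have := @expR_le_quad (- t).
  by rewrite normrN sqrrN => /(_ t2); lra.
have H : `|t| <= 2 * t ^+ 2.
  by rewrite -real_normK ?num_real// expr2; have := normr_ge0 t; nra.
have: expR t <= expR (2 * t ^+ 2) by rewrite ler_expR (le_trans (ler_norm _)).
have: expR (- t) <= expR (2 * t ^+ 2).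
  by rewrite ler_expR (le_trans (ler_norm _))// normrN.
lra.
Qed.

Lemma Ex_expR_ip N x : Ex N (fun u => expR (ip N x u)) <= expR (2 * nsq N x).
Proof.
elim: N x => [|N IH] x /=; first by rewrite /ip /nsq !big_ord0 mulr0.
have E e : Ex N (fun u => expR (ip N.+1 x (scons e u))) =
    expR (x 0 * e) * Ex N (fun u => expR (ip N (fun k => x k.+1) u)).
  by rewrite -ExZ; apply: eq_Ex => u; rewrite ip_scons expRD.
rewrite !E mulr1 mulrN1 -mulrDl mulrA nsqS [2 * (_ + _)]mulrDr expRD.
apply: ler_pM; [| |exact: cosh_le|exact: IH].
  by rewrite mulr_ge0 ?invr_ge0// addr_ge0// expR_ge0.
by rewrite -(Ex_cst N 0); apply: le_Ex => u; exact: expR_ge0.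
Qed.

Lemma Ex_ip2 N x : Ex N (fun u => ip N x u ^+ 2) = nsq N x.
Proof.
elim: N x => [|N IH] x /=; first by rewrite /ip /nsq !big_ord0 expr0n.
rewrite nsqS -IH -ExD -ExZ -[X in X + _](Ex_cst N) -ExD.
by apply: eq_Ex => u; rewrite !ip_scons; field.
Qed.

(** Averaging over the first sign kills the odd powers. With [a = x 0 ^+ 2] and [b] the squared norm
    of the tail, the new terms are [a^2 + 6 a b], at most [3 (a + b)^2 - 3 b^2]. *)
Lemma Ex_ip4 N x : Ex N (fun u => ip N x u ^+ 4) <= 3 * nsq N x ^+ 2.
Proof.
elim: N x => [|N IH] x /=; first by rewrite /ip /nsq !big_ord0 !expr0n mulr0.
set y := fun k => x k.+1.
have -> : 2^-1 * (Ex N (fun u => ip N.+1 x (scons 1 u) ^+ 4) +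
                  Ex N (fun u => ip N.+1 x (scons (-1) u) ^+ 4)) =
          x 0 ^+ 4 + 6 * x 0 ^+ 2 * nsq N y + Ex N (fun u => ip N y u ^+ 4).
  rewrite -(Ex_ip2 N y) -[x 0 ^+ 4](Ex_cst N) -ExZ -!ExD -ExZ.
  by apply: eq_Ex => u; rewrite !ip_scons -/y; field.
have := IH y; rewrite nsqS -/y => H.
have := nsq_ge0 N y; have := sqr_ge0 (x 0).
rewrite (_ : x 0 ^+ 4 = (x 0 ^+ 2) ^+ 2); last by rewrite -exprM.
by move: (x 0 ^+ 2) (nsq N y) H => a b; nra.
Qed.

(* Paley-Zygmund: the indicator of [Z >= s / 4] dominates
   [1 - (1 - (Z - s / 4) / (4 s)) ^+ 2]. *)
Lemma Ex_ip_large N x : 0 < nsq N x ->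
  5^-1 <= Ex N (fun u => (nsq N x / 4 <= ip N x u ^+ 2)%R%:R).
Proof.
set s := nsq N x => s0.
have H u : (2 * s)^-1 * (ip N x u ^+ 2 - s / 4)
    - (4 * s)^-1 ^+ 2 * (ip N x u ^+ 4 - s / 2 * ip N x u ^+ 2 + s ^+ 2 / 16)
    <= (s / 4 <= ip N x u ^+ 2)%R%:R.
  set z := ip N x u ^+ 2.
  rewrite (_ : ip N x u ^+ 4 = z ^+ 2); last by rewrite -exprM.
  rewrite [leLHS](_ : _ = 1 - (1 - (4 * s)^-1 * (z - s / 4)) ^+ 2); last first.
    by field; rewrite gt_eqF.
  have [zs|zs] := lerP (s / 4) z; first by rewrite lerBlDr lerDl sqr_ge0.
  have : (4 * s)^-1 * (z - s / 4) < 0.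
    by rewrite pmulr_rlt0 ?subr_lt0// invr_gt0; lra.
  by move: (_ * _) => y y0; rewrite mulr0n; nra.
apply: le_trans (le_Ex N H).
rewrite ExB !ExZ ExB Ex_cst Ex_ip2 -/s ExD Ex_cst ExB ExZ Ex_ip2 -/s.
have H4 : (4 * s)^-1 ^+ 2 * (Ex N (fun u => ip N x u ^+ 4) - s / 2 * s + s ^+ 2 / 16)
   <= (4 * s)^-1 ^+ 2 * (3 * s ^+ 2 - s / 2 * s + s ^+ 2 / 16).
  by rewrite ler_wpM2l ?sqr_ge0// !lerD// Ex_ip4.
(* For [Z] the squared inner product, [E Z = s] and [E Z^2 <= 3 s^2] give [3/8 - 41/256 = 55/256],
   just above [1/5]. *)
have -> : 5^-1 = (2 * s)^-1 * (s - s / 4) -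
   ((4 * s)^-1 ^+ 2 * (3 * s ^+ 2 - s / 2 * s + s ^+ 2 / 16)) - (55 / 256 - 5^-1).
  by field; rewrite gt_eqF.
lra.
Qed.

Lemma Ex_sqr_ge N F : Ex N F ^+ 2 <= Ex N (fun u => F u ^+ 2).
Proof.
have : 0 <= Ex N (fun u => (F u - Ex N F) ^+ 2).
  by rewrite -(Ex_cst N 0); apply: le_Ex => u; exact: sqr_ge0.
under eq_Ex => u do rewrite sqrrB -mulrnAr -[(F u * _)]mulrC.
by rewrite ExD ExB ExZ !Ex_cst; move: (Ex N F) => a; lra.
Qed.

(* Efron-Stein inequality for functions with a subgradient [X u] at every [u]. *)
Lemma Ex_variance N F (X : (nat -> R) -> nat -> R) :
  (forall u v, F u - F v <= ip N (X u) (fun k => u k - v k)) ->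
  Ex N (fun u => F u ^+ 2) - Ex N F ^+ 2 <= 2 * Ex N (fun u => nsq N (X u)).
Proof.
elim: N F X => [|N IH] F X FX /=.
  by rewrite subrr /nsq big_ord0 mulr0.
pose F1 e := fun u => F (scons e u).
pose X1 e := fun u k => X (scons e u) k.+1.
have F1X e u v : F1 e u - F1 e v <= ip N (X1 e u) (fun k => u k - v k).
  apply: le_trans (FX _ _) _.
  by rewrite /ip big_ord_recl/= subrr mulr0 add0r.
have dF e u : F1 e u - F1 (- e) u <= X (scons e u) 0 * (2 * e).
  apply: le_trans (FX _ _) _; rewrite /ip big_ord_recl/= big1 => [|k _].
    by rewrite addr0 opprK mulr_natl mulr2n.
  by rewrite subrr mulr0.
have V1 := IH _ _ (F1X 1); have V2 := IH _ _ (F1X (-1)).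
(* Whichever sign the difference has, one of the two subgradients bounds it. The variance is the
   average of the two conditional variances plus a quarter of this squared difference of conditional
   means. *)
have D : (Ex N (F1 1) - Ex N (F1 (-1))) ^+ 2 <=
    4 * Ex N (fun u => X (scons 1 u) 0 ^+ 2) +
    4 * Ex N (fun u => X (scons (-1) u) 0 ^+ 2).
  rewrite -ExB -!ExZ -ExD; apply: le_trans (Ex_sqr_ge _ _) _; apply: le_Ex => u.
  have := dF 1 u; have := dF (-1) u; rewrite opprK.
  move: (X _ 0) (X _ 0) => a b Ha Hb.
  have [?|?] := lerP 0 (F1 1 u - F1 (-1) u); nra.
rewrite -/(F1 1) -/(F1 (-1)) in V1 V2 D *.
have -> : Ex N (fun u => nsq N.+1 (X (scons 1 u))) =
    Ex N (fun u => X (scons 1 u) 0 ^+ 2) + Ex N (fun u => nsq N (X1 1 u)).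
  by rewrite -ExD; apply: eq_Ex => u; rewrite nsqS.
have -> : Ex N (fun u => nsq N.+1 (X (scons (-1) u))) =
    Ex N (fun u => X (scons (-1) u) 0 ^+ 2) + Ex N (fun u => nsq N (X1 (-1) u)).
  by rewrite -ExD; apply: eq_Ex => u; rewrite nsqS.
change (Ex N (fun u => F (scons 1 u))) with (Ex N (F1 1)).
change (Ex N (fun u => F (scons (-1) u))) with (Ex N (F1 (-1))).
change (Ex N (fun u => F (scons 1 u) ^+ 2)) with (Ex N (fun u => F1 1 u ^+ 2)).
change (Ex N (fun u => F (scons (-1) u) ^+ 2))
  with (Ex N (fun u => F1 (-1) u ^+ 2)).
by move: V1 V2 D; nra.
Qed.

(** The pointwise bound [y <= y^2 / (2 tau) + tau / 2] replaces Cauchy-Schwarz. *)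
Lemma Ex_abs_dev N F b tau : 0 < tau ->
  Ex N (fun u => F u ^+ 2) - Ex N F ^+ 2 <= b -> b <= tau ^+ 2 ->
  Ex N (fun u => `|F u - Ex N F|) <= tau.
Proof.
move=> t0 Vb bt; set a := Ex N F.
have H : Ex N (fun u => `|F u - a|) <=
    Ex N (fun u => (2 * tau)^-1 * (F u ^+ 2 - 2 * a * F u + a ^+ 2) + tau / 2).
  apply: le_Ex => u; have -> : F u ^+ 2 - 2 * a * F u + a ^+ 2 = `|F u - a| ^+ 2.
    by rewrite real_normK ?num_real//; ring.
  move: `|F u - a| => y; rewrite -subr_ge0.
  rewrite [X in 0 <= X](_ : _ = (2 * tau)^-1 * (y - tau) ^+ 2); last first.
    by field; rewrite gt_eqF.
  by rewrite mulr_ge0 ?sqr_ge0// invr_ge0; lra.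
apply: le_trans H _.
rewrite ExD Ex_cst ExZ ExD Ex_cst ExB ExZ -/a.
have : (2 * tau)^-1 * (Ex N (fun u => F u ^+ 2) - 2 * a * a + a ^+ 2) <=
       (2 * tau)^-1 * tau ^+ 2.
  rewrite ler_wpM2l//; first by rewrite invr_ge0; lra.
  by rewrite /a; nra.
have -> : (2 * tau)^-1 * tau ^+ 2 = tau / 2 by field; rewrite gt_eqF.
lra.
Qed.

End Rademacher.

(** * Sweep cuts and rounding *)

Section WeightedSets.
Variables (R : realType) (I : finType).
Implicit Types (p r y z : I -> R) (A B : pred I) (W d : I -> I -> R).

Lemma ler_sum_pred p A B : (forall i, 0 <= p i) -> (forall i, A i -> B i) ->
  \sum_(i | A i) p i <= \sum_(i | B i) p i.
Proof.
move=> p0 AB; rewrite big_mkcond [leRHS]big_mkcond/=; apply: ler_sum => i _.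
by have := AB i; case: (A i); case: (B i) => //= /(_ isT).
Qed.

(** Take for [m] the least value of [r] on [A] whose sublevel set carries half of the mass; by
    minimality the part strictly below [m] carries less than half. *)
Lemma weighted_median p r A : (forall i, 0 <= p i) ->
  exists m, (\sum_(i | A i) p i) / 2 <= \sum_(i | A i && (r i <= m)) p i /\
            (\sum_(i | A i) p i) / 2 <= \sum_(i | A i && (m <= r i)) p i.
Proof.
move=> p0; set t := \sum_(i | A i) p i.
have t0 : 0 <= t by apply: sumr_ge0.
have [/existsP[i0 Ai0]|A0] := boolP [exists i, A i]; last first.
  exists 0; have -> : t = 0.
    by apply: big1 => i Ai; case/existsP: A0; exists i.
  by rewrite mul0r; split; apply: sumr_ge0.
pose P i := A i && (t / 2 <= \sum_(j | A j && (r j <= r i)) p j).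
have [i1 Ai1 max1] := arg_maxP r Ai0.
have Pi1 : P i1.
  rewrite /P; apply/andP; split=> //.
  rewrite (_ : \sum_(_ | _ && _) _ = t); first by lra.
  by apply: eq_bigl => j; case Aj: (A j) => //=; exact: max1.
have [i2 /andP[Ai2 t2] min2] := arg_minP r Pi1.
exists (r i2); split=> //; rewrite leNgt; apply/negP => lt2.
have tE : t = \sum_(j | A j && (r i2 <= r j)) p j
            + \sum_(j | A j && (r j < r i2)) p j.
  rewrite /t (bigID (fun j => r i2 <= r j))/=; congr (_ + _).
  by apply: eq_bigl => j; rewrite -ltNge.
have [/existsP[i3 Pi3]|N] := boolP [exists j, A j && (r j < r i2)]; last first.
  move: tE; rewrite [X in _ + X]big1 => [|j Pj]; first by lra.
  by case/existsP: N; exists j.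
have [i4 /andP[Ai4 r4] max4] := @arg_maxP _ _ _ i3
  (fun j => A j && (r j < r i2)) r Pi3.
have /min2 : P i4.
  rewrite /P Ai4/=; apply: (@le_trans _ _ (\sum_(j | A j && (r j < r i2)) p j)).
    by lra.
  apply: ler_sum_pred => // j /andP[Aj rj]; rewrite Aj/=.
  by apply: max4; rewrite Aj.
by rewrite leNgt => /negP; apply.
Qed.

(** Pairs are processed one by one, each receiving all the capacity left at both ends. This
    saturates an end, and later pairs never release capacity, so the final fractional matching is
    maximal: the last clause. *)
Lemma greedy_matching (al be : I -> R) (Q : rel I) :
  (forall i, 0 <= al i) -> (forall i, 0 <= be i) ->
  exists m : I -> I -> R,
    [/\ forall i j, 0 <= m i j,
        forall i j, m i j != 0 -> Q i j,
        forall i, \sum_j m i j <= al i,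
        forall j, \sum_i m i j <= be j
      & forall i j, Q i j -> \sum_k m i k = al i \/ \sum_k m k j = be j].
Proof.
move=> al0 be0.
suff [m [m0 mQ ma mb ms]] : exists m : I -> I -> R,
    [/\ forall i j, 0 <= m i j,
        forall i j, m i j != 0 -> Q i j,
        forall i, \sum_j m i j <= al i,
        forall j, \sum_i m i j <= be j
      & forall c, c \in enum {: I * I} -> Q c.1 c.2 ->
          \sum_k m c.1 k = al c.1 \/ \sum_k m k c.2 = be c.2].
  by exists m; split=> // i j; apply: (ms (i, j)); rewrite mem_enum.
elim: (enum _) => [|[a b] s [m [m0 mQ ma mb ms]]].
  exists (fun _ _ => 0); split=> // [i j|i|i]; first by rewrite eqxx.
  - by rewrite big1.
  - by rewrite big1.
have [Qab|nQab] := boolP (Q a b); last first.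
  exists m; split=> // c; rewrite inE => /orP[/eqP-> /=|]; last exact: ms.
  by rewrite (negbTE nQab).
pose e := Num.min (al a - \sum_j m a j) (be b - \sum_i m i b).
have e0 : 0 <= e by rewrite le_min !subr_ge0 ma mb.
pose m' i j := m i j + (if (i == a) && (j == b) then e else 0).
have rowE i : \sum_j m' i j = \sum_j m i j + (if i == a then e else 0).
  rewrite big_split/=; congr (_ + _); case: (i == a) => /=; last by rewrite big1.
  by rewrite -big_mkcond big_pred1_eq.
have colE j : \sum_i m' i j = \sum_i m i j + (if j == b then e else 0).
  rewrite big_split/=; congr (_ + _); case: (j == b) => /=.
    under eq_bigr do rewrite andbT.
    by rewrite -big_mkcond big_pred1_eq.
  by rewrite big1// => i _; rewrite andbF.
have ea : e <= al a - \sum_j m a j by rewrite ge_min lexx.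
have eb : e <= be b - \sum_i m i b by rewrite ge_min lexx orbT.
have ma' i : \sum_j m' i j <= al i.
  by rewrite rowE; case: eqP => [->|_]; [lra|rewrite addr0].
have mb' j : \sum_i m' i j <= be j.
  by rewrite colE; case: eqP => [->|_]; [lra|rewrite addr0].
exists m'; split=> //.
- by move=> i j; rewrite /m'; case: ifP => _; rewrite ?addr0// addr_ge0.
- move=> i j; rewrite /m'; case: ifP => [/andP[/eqP-> /eqP->]//|_].
  by rewrite addr0; exact: mQ.
move=> c; rewrite inE => /orP[/eqP->/= _|cs Qc].
  rewrite rowE colE !eqxx.
  have [E|E] : e = al a - \sum_j m a j \/ e = be b - \sum_i m i b.
    by rewrite /e; case: leP; [left|right].
  - by left; rewrite E; lra.
  - by right; rewrite E; lra.
have [E|E] := ms _ cs Qc.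
- left; apply: le_anti; rewrite ma'/= -[leLHS]E rowE lerDl.
  by case: ifP.
- right; apply: le_anti; rewrite mb'/= -[leLHS]E colE lerDl.
  by case: ifP.
Qed.

(* Layer-cake formula for the level sets of [y], peeling off one layer (up to
   the least positive value of [y]) at a time. *)
Lemma sweep W p kappa : (forall i j, 0 <= W i j) -> forall y,
  (forall i, 0 <= y i) ->
  (forall t, 0 <= t -> kappa * (\sum_(i | t < y i) p i) <=
     \sum_(i | y i <= t) \sum_(j | t < y j) W i j) ->
  kappa * (\sum_i p i * y i) <= \sum_i \sum_j W i j * Num.max 0 (y j - y i).
Proof.
move=> W0 y; have [k] := ubnP #|[pred i | 0 < y i]|.
elim: k y => // k IH y; rewrite ltnS => yk y0 H.
have [/existsP[i0 yi0]|y00] := boolP [exists i, 0 < y i]; last first.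
  rewrite big1 => [|i _].
    rewrite mulr0; apply: sumr_ge0 => i _; apply: sumr_ge0 => j _.
    by rewrite mulr_ge0// le_max lexx.
  suff -> : y i = 0 by rewrite mulr0.
  apply: le_anti; rewrite y0 andbT leNgt; apply/negP => yi.
  by case/existsP: y00; exists i.
have [i1 /= yi1 min1] := @arg_minP _ _ _ i0 (fun i => 0 < y i) y yi0.
set t := y i1 in yi1 min1.
pose y' i := Num.max 0 (y i - t).
have y'P i : (y i = 0 /\ y' i = 0) \/ (0 < y i /\ y' i = y i - t).
  have := y0 i; rewrite le_eqVlt => /orP[/eqP yi|yi].
    by left; split=> //; rewrite /y' -yi max_l//; lra.
  by right; split=> //; rewrite /y' max_r// subr_ge0 min1.
have y'0 i : 0 <= y' i by rewrite le_max lexx.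
have y'lt s i : 0 <= s -> (s < y' i) = (s + t < y i).
  by move=> s0; case: (y'P i) => -[yi ->]; rewrite ?yi; apply/idP/idP; lra.
have yE i : p i * y i = p i * y' i + t * (if 0 < y i then p i else 0).
  by case: (y'P i) => -[yi ->]; [rewrite yi ltxx|rewrite yi]; ring.
have WE i j : W i j * Num.max 0 (y j - y i) = W i j * Num.max 0 (y' j - y' i)
    + t * (if y i <= 0 then if 0 < y j then W i j else 0 else 0).
  case: (y'P i) => -[yi ->]; case: (y'P j) => -[yj ->].
  - by rewrite yi yj lexx ltxx; ring.
  - rewrite yi lexx yj !max_r; [ring|have := min1 _ yj; lra|lra].
  - rewrite (leNgt (y i)) yi yj/= !max_l; [ring|have := min1 _ yi; lra|lra].
  - rewrite (leNgt (y i)) yi/= mulr0 addr0; congr (_ * Num.max _ _); ring.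
have IHy' : kappa * (\sum_i p i * y' i) <=
    \sum_i \sum_j W i j * Num.max 0 (y' j - y' i).
  apply: IH => //.
    apply: leq_trans yk; apply: proper_card; apply/properP; split.
      by apply/fintype.subsetP => i; rewrite !inE y'lt// add0r; exact: lt_trans.
    by exists i1; rewrite !inE// y'lt// add0r -/t ltxx.
  move=> s s0; have st0 : 0 <= s + t by lra.
  have := H _ st0; congr (_ * _ <= _); first by apply: eq_bigl => i; rewrite y'lt.
  apply: eq_big => [i|i _]; first by rewrite leNgt -y'lt// -leNgt.
  by apply: eq_bigl => j; rewrite y'lt.
rewrite (eq_bigr _ (fun i _ => yE i)) big_split/= mulrDr.
rewrite (eq_bigr _ (fun i _ => eq_bigr _ (fun j _ => WE i j))).
under [leRHS]eq_bigr do rewrite big_split.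
rewrite big_split/= lerD// -mulr_sumr -big_mkcond/=.
under [leRHS]eq_bigr do rewrite -mulr_sumr.
rewrite -mulr_sumr mulrCA ler_wpM2l ?(ltW yi1)//.
apply: le_trans (H 0 (lexx _)) _; rewrite [leLHS]big_mkcond/=.
apply: ler_sum => i _; case: ifP => _; last by rewrite big1.
by rewrite [leLHS]big_mkcond.
Qed.

(** * Rounding in an expanding weighted graph *)

Definition cut W A : R := \sum_(i | A i) \sum_(j | ~~ A j) W i j.

Section Rounding.
Variables (p : I -> R) (d : I -> I -> R) (kappa : R).
Hypothesis p0 : forall i, 0 <= p i.
Hypothesis p1 : \sum_i p i = 1.
Hypothesis d0 : forall i, d i i = 0.
Hypothesis dC : forall i j, d i j = d j i.
Hypothesis dtri : forall i j k, d i j <= d i k + d k j.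
Hypothesis kappa0 : 0 <= kappa.

Let pred_ge0 A : 0 <= \sum_(i | A i) p i. Proof. exact: sumr_ge0. Qed.
Let pred_le1 A : \sum_(i | A i) p i <= 1.
Proof. by rewrite -p1; apply: ler_sum_pred. Qed.
Let d_ge0 i j : 0 <= d i j.
Proof. by have := dtri i i j; rewrite d0 (dC j i); lra. Qed.

Definition expanding W := forall A : pred I,
  kappa * Num.min (\sum_(i | A i) p i) (\sum_(i | ~~ A i) p i) <= cut W A.

(* Sweeping over [x j := min_(a in A) (d a j - r a + r j)], which increases along
   an edge [(i, j)] by at most [d i j - r i + r j]. *)
Lemma rounding W r z A a : (forall i j, 0 <= W i j) -> expanding W ->
  0 < a -> a <= \sum_(i | A i) p i ->
  (forall i j, A i -> z j <= d i j - r i + r j) ->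
  kappa * a * (\sum_j p j * Num.max 0 (z j)) <=
  \sum_i \sum_j W i j * Num.max 0 (d i j - r i + r j).
Proof.
move=> W0 Wexp a0 aA zA.
have [/existsP[i0 Ai0]|A0] := boolP [exists i, A i]; last first.
  move: aA; rewrite big1 => [|i Ai]; first by lra.
  by case/existsP: A0; exists i.
pose near j := [arg min_(i < i0 | A i) (d i j - r i)]%O.
have nearP j : A (near j) /\ forall i, A i -> d (near j) j - r (near j) <= d i j - r i.
  by rewrite /near; case: (@arg_minP _ _ _ i0 A (fun i => d i j - r i) Ai0).
pose x j := d (near j) j - r (near j) + r j.
have xA i : A i -> x i <= 0.
  by move=> Ai; have [_ /(_ _ Ai)] := nearP i; rewrite /x d0; lra.
have xE i j : x j - x i <= d i j - r i + r j.
  have [Ai _] := nearP i; have [_ /(_ _ Ai)] := nearP j.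
  by rewrite /x; have := dtri (near i) j i; lra.
have zx j : z j <= x j by apply: zA; have [] := nearP j.
pose y j := Num.max 0 (x j).
have S := @sweep W p (kappa * a) W0 y _ _.
apply: le_trans (_ : kappa * a * (\sum_j p j * y j) <= _).
  rewrite ler_wpM2l//; first by rewrite mulr_ge0// ltW.
  apply: ler_sum => j _; rewrite ler_wpM2l// /y ge_max le_max lexx/=.
  by rewrite le_max zx orbT.
apply: le_trans (S _ _) _.
- by move=> i; rewrite le_max lexx.
- move=> t t0; have := Wexp (fun i => y i <= t).
  have E : forall F : I -> R, \sum_(i | ~~ (y i <= t)) F i = \sum_(i | t < y i) F i.
    by move=> F; apply: eq_bigl => i; rewrite -ltNge.
  rewrite E => cutE; apply: le_trans (le_trans _ cutE) _; last first.
    by rewrite /cut; under eq_bigr do rewrite E.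
  (* Every sublevel set contains [A], where [x <= 0], so it has mass at least [a]. Both masses being
     at most [1], their minimum is at least [a] times the mass above [t]. *)
  rewrite -mulrA ler_wpM2l// le_min.
  have AS : a <= \sum_(i | y i <= t) p i.
    apply: le_trans aA _; apply: ler_sum_pred => // i /xA xi.
    by rewrite /y max_l.
  have := pred_ge0 (fun i => t < y i); have := pred_le1 (fun i => t < y i).
  have := pred_le1 (fun i => y i <= t).
  by move: AS; move: (\sum_(i | _) p i) (\sum_(i | _) p i) => s1 s2 *; apply/andP; split; nra.
- apply: ler_sum => i _; apply: ler_sum => j _; rewrite ler_wpM2l//.
  rewrite ge_max le_max lexx/=; have := xE i j; rewrite /y.
  case: (lerP 0 (x i)) => xi; case: (lerP 0 (x j)) => xj H; rewrite le_max; apply/orP.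
  + by right.
  + by left; lra.
  + by right; lra.
  + by left; lra.
Qed.

(** The potential could cancel the distance, so the sets are cut at a median [m] of [r] on [L]. If
    [B] has mass above [m], the source is the lower half of [L]; otherwise [B] has mass below [m]
    and the roles are swapped by symmetry of [d]. Either way [r] does not decrease from source to
    target. *)
Lemma directed_separated W r (L B : pred I) c Delta :
  (forall i j, 0 <= W i j) -> expanding W -> 0 < c -> 0 <= Delta ->
  c <= \sum_(i | L i) p i -> c <= \sum_(i | B i) p i ->
  (forall i j, L i -> B j -> Delta <= d i j) ->
  kappa * (c / 2) * (c / 2 * Delta) <=
  \sum_i \sum_j W i j * Num.max 0 (d i j - r i + r j).
Proof.
move=> W0 Wexp c0 D0 cL cB LB.
suff [A [A' [m [cA cA' Am Am' AA']]]] : exists A A' m,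
    [/\ c / 2 <= \sum_(i | A i) p i, c / 2 <= \sum_(i | A' i) p i,
        forall i, A i -> r i <= m, forall i, A' i -> m <= r i
      & forall i j, A i -> A' j -> Delta <= d i j].
  pose z j := if A' j then Delta else r j - m.
  apply: le_trans (@rounding W r z A (c / 2) W0 Wexp _ cA _).
  - rewrite ler_wpM2l//; first by rewrite mulr_ge0//; lra.
    rewrite mulrC; apply: le_trans (_ : Delta * \sum_(i | A' i) p i <= _).
      by rewrite ler_wpM2l.
    rewrite mulr_sumr [leLHS]big_mkcond; apply: ler_sum => j _; rewrite /z.
    case: ifP => _; first by rewrite mulrC ler_wpM2l// le_max lexx orbT.
    by rewrite mulr_ge0// le_max lexx.
  - by lra.
  - move=> i j Ai; rewrite /z; have := Am _ Ai; have := d_ge0 i j.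
    by case: ifP => [A'j|_]; [have := AA' _ _ Ai A'j; have := Am' _ A'j|]; lra.
have [m [m1 m2]] := weighted_median r L p0.
have [H|H] := lerP (c / 2) (\sum_(i | B i && (m <= r i)) p i).
  exists (fun i => L i && (r i <= m)), (fun i => B i && (m <= r i)), m.
  split=> //; [lra|by move=> i /andP[]|by move=> i /andP[]|].
  by move=> i j /andP[Li _] /andP[Bj _]; exact: LB.
exists (fun i => B i && (r i <= m)), (fun i => L i && (m <= r i)), m.
split=> //; [|lra|by move=> i /andP[]|by move=> i /andP[]|].
  suff : \sum_(i | B i) p i <= \sum_(i | B i && (m <= r i)) p i
     + \sum_(i | B i && (r i <= m)) p i by lra.
  rewrite (bigID (fun i => m <= r i))/= lerD2l; apply: ler_sum_pred => // i.
  by rewrite -ltNge => /andP[-> /ltW].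
by move=> i j /andP[Bi _] /andP[Lj _]; rewrite dC; exact: LB.
Qed.

(** Both halves of [A] around a median of [r] have mass at least [a / 2]. If half of the [rho]-mass
    lies above the median, rounding starts from the lower half; otherwise all edges are reversed and
    [r] negated, which leaves the right-hand side unchanged. *)
Lemma directed_concentrated W r (A : pred I) rho a b :
  (forall i j, 0 <= W i j) -> expanding W -> expanding (fun i j => W j i) ->
  0 < a -> a <= \sum_(i | A i) p i ->
  (forall j, 0 <= rho j) -> (forall i j, A i -> rho j <= d i j) ->
  b <= \sum_j p j * rho j ->
  kappa * (a / 2) * (b / 2) <=
  \sum_i \sum_j W i j * Num.max 0 (d i j - r i + r j).
Proof.
move=> W0 Wexp Wexp' a0 aA rho0 rhoA brho.
have one_sided (V : I -> I -> R) (s : I -> R) m : (forall i j, 0 <= V i j) -> expanding V ->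
    a / 2 <= \sum_(i | A i && (s i <= m)) p i ->
    b / 2 <= \sum_(j | m <= s j) p j * rho j ->
    kappa * (a / 2) * (b / 2) <=
    \sum_i \sum_j V i j * Num.max 0 (d i j - s i + s j).
  move=> V0 Vexp am bm.
  pose z j := if m <= s j then rho j else s j - m.
  apply: le_trans (@rounding V s z (fun i => A i && (s i <= m)) (a / 2) V0 Vexp _ am _).
  - rewrite ler_wpM2l//; first by rewrite mulr_ge0//; lra.
    apply: le_trans bm _; rewrite [leLHS]big_mkcond; apply: ler_sum => j _; rewrite /z.
    case: ifP => _; first by rewrite ler_wpM2l// le_max lexx orbT.
    by rewrite mulr_ge0// le_max lexx.
  - by lra.
  - move=> i j /andP[Ai si]; rewrite /z; have := d_ge0 i j; have := rhoA i j Ai.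
    by case: ifP => [sj|_]; lra.
have [m [m1 m2]] := weighted_median r A p0.
have [H|H] := lerP (b / 2) (\sum_(j | m <= r j) p j * rho j).
  by apply: (one_sided _ _ m) => //; lra.
have := one_sided (fun i j => W j i) (fun i => - r i) (- m).
rewrite exchange_big/= => /(_ _ _ _ _)/le_trans; apply => //.
- apply: le_trans (_ : (\sum_(i | A i) p i) / 2 <= _); first by lra.
  by apply: le_trans m2 _; apply: ler_sum_pred => // i /andP[-> ?]; rewrite lerN2.
- have : \sum_j p j * rho j <= \sum_(j | m <= r j) p j * rho j
      + \sum_(j | - m <= - r j) p j * rho j.
    rewrite (bigID (fun j => m <= r j))/= lerD2l.
    apply: (@ler_sum_pred (fun j => p j * rho j)) => [i|i]; first by rewrite mulr_ge0.
    by rewrite lerN2 -ltNge => /ltW.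
  by lra.
- apply: ler_sum => i _; apply: ler_sum => j _; rewrite dC.
  by rewrite (_ : d i j - - r j + - r i = d i j - r i + r j)//; ring.
Qed.

End Rounding.
End WeightedSets.

(** * Circulation duality *)

Section Duality.
Variables (R : realType) (I : finType).

Lemma continuous_sumr (T : topologicalType) (J : Type) (s : seq J) (P : pred J)
    (f : J -> T -> R) :
  (forall j, continuous (f j)) -> continuous (fun x => \sum_(j <- s | P j) f j x).
Proof.
move=> fc; elim: s => [|j s IH] x.
  by under eq_fun do rewrite big_nil; exact: cst_continuous.
case Pj: (P j); last by under eq_fun do rewrite big_cons Pj; exact: IH.
by under eq_fun do rewrite big_cons Pj; apply: continuousD; [exact: fc|exact: IH].
Qed.

Variables W c : I -> I -> R.
Hypothesis W0 : forall i j, 0 <= W i j.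
Hypothesis c0 : forall i j, 0 <= c i j.

(** The product topology makes [box] compact by Tychonoff's theorem. *)
Local Notation flow := (prod_topology (fun _ : I * I => R)).

Let box : set flow := 
  [set F : flow | forall e, `[0, W e.1 e.2]%classic (F e)]%classic.

Let excess (F : I * I -> R) i := \sum_j F (i, j) - \sum_j F (j, i).
Let cost (F : I * I -> R) := \sum_i \sum_j F (i, j) * c i j.
Let defect (F : I * I -> R) := \sum_i excess F i ^+ 2.

Let boxP (F : flow) : box F <-> forall i j, 0 <= F (i, j) <= W i j.
Proof.
split=> [H i j|H [i j]]; last by rewrite /= in_itv/=.
by have := H (i, j); rewrite /= in_itv.
Qed.

Let box_compact : compact box.
Proof.
by apply: (@tychonoff _ _ (fun e => `[0, W e.1 e.2]%classic)) => e;
  exact: segment_compact.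
Qed.

Let eval_continuous e : continuous (fun F : flow => F e).
Proof. exact: (@proj_continuous _ (fun _ : I * I => R)). Qed.

Let cost_continuous : continuous (cost : flow -> R).
Proof.
apply: continuous_sumr => i; apply: continuous_sumr => j F.
by apply: continuousM; [exact: eval_continuous|exact: cst_continuous].
Qed.

Let defect_continuous : continuous (defect : flow -> R).
Proof.
apply: continuous_sumr => i F.
have exc : continuous (fun F : flow => excess F i).
  by move=> F'; apply: continuousB; apply: continuous_sumr => j; exact: eval_continuous.
exact: (continuousM (exc F) (exc F)).
Qed.

Let defect_ge0 F : 0 <= defect F.
Proof. by apply: sumr_ge0 => i _; exact: sqr_ge0. Qed.

Variable lam : R.
Hypothesis circ_le : forall F : I -> I -> R,
  (forall i j, 0 <= F i j <= W i j) ->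
  (forall i, \sum_j F i j = \sum_j F j i) ->
  \sum_i \sum_j F i j * c i j <= lam.

(** On the compact set of flows of cost at least [lam + eps] the defect attains its minimum, and the
    minimum is positive: a flow without defect is a circulation, whose cost is at most [lam]. *)
Let defect_gap eps : 0 < eps ->
  exists2 eta, 0 < eta & forall F, box F -> defect F < eta -> cost F < lam + eps.
Proof.
move=> eps0.
pose K := (box `&` (cost : flow -> R) @^-1` [set x | lam + eps <= x])%classic.
have Kc : compact K.
  apply: compact_closedI => //; apply: (@preimage_closed flow R cost);
    last exact: closed_ge.
  by move=> F _; exact: cost_continuous.
have [/existsNP[F /contrapT KF]|K0] := pselect (~ forall F, ~ K F); last first.
  exists 1 => // F bF _; rewrite ltNge; apply/negP => cF.
  by move/contrapT: K0 => /(_ F); apply.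
have KN : (K !=set0)%classic by exists F.
have [F0 /set_mem[b0 /= c00] min0] := compact_EVT_min KN Kc
  (continuous_subspaceT defect_continuous).
exists (defect F0).
  rewrite lt_neqAle defect_ge0 andbT; apply/eqP => /esym D0.
  have := @circ_le (fun i j => F0 (i, j)) ((boxP F0).1 b0).
  move=> /(_ _)/(le_trans c00); rewrite gerDl leNgt eps0/=.
  suff H i : \sum_j F0 (i, j) = \sum_j F0 (j, i) by move=> /(_ H).
  apply/eqP; rewrite -subr_eq0 -sqrf_eq0; apply/eqP.
  have /psumr_eq0P := D0; apply => // k _; exact: sqr_ge0.
move=> F' bF'; rewrite !ltNge; apply: contra => cF'.
by apply: min0; rewrite inE.
Qed.

(* A maximiser [F] over the box of [cost - defect / (2 mu)] satisfies
   complementary slackness for the potential [excess F / mu]; its defect is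
   [O(mu)], so it is almost a circulation. *)
Lemma circulation_duality eps : 0 < eps ->
  exists r : I -> R,
    \sum_i \sum_j W i j * Num.max 0 (c i j - r i + r j) <= lam + eps.
Proof.
move=> eps0; have [eta eta0 gap] := defect_gap eps0.
pose C := \sum_i \sum_j W i j * c i j.
have C0 : 0 <= C.
  by apply: sumr_ge0 => i _; apply: sumr_ge0 => j _; exact: mulr_ge0.
(* Comparing the maximiser with the zero flow will bound its defect by [2 mu C]; this [mu] brings
   that below [eta], so that [defect_gap] applies. *)
pose mu := eta / (2 * (C + 1)).
have mu0 : 0 < mu by rewrite divr_gt0//; lra.
have muC : 2 * mu * C < eta.
  rewrite /mu (_ : 2 * _ * C = eta * (C / (C + 1))); last by field; lra.
  by rewrite gtr_pMr// ltr_pdivrMr; lra.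
pose val (F : flow) := cost F - (2 * mu)^-1 * defect F.
have val_cont : continuous val.
  move=> F; apply: continuousB; first exact: cost_continuous.
  by apply: continuousM; [exact: cst_continuous|exact: defect_continuous].
have box0 : box (fun=> 0) by apply/boxP => i j; rewrite lexx W0.
have boxN : (box !=set0)%classic by exists (fun=> 0).
have [F /set_mem bF maxF] := compact_EVT_max boxN box_compact
  (continuous_subspaceT val_cont).
have {}maxF F' : box F' -> val F' <= val F by move=> b'; apply: maxF; rewrite inE.
have FW i j := (boxP F).1 bF i j.
pose r i := excess F i / mu.
exists r.
pose g i j := c i j - r i + r j.
(* Changing the flow on a single edge by [s] alters the objective by [s g] minus a term of at most
   [s^2 / mu], which maximality forbids to be positive. *)
have step i j s : 0 <= F (i, j) + s <= W i j -> s * g i j <= s ^+ 2 / mu.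
  move=> sP; pose e k : R := (k == i)%:R - (k == j)%:R.
  pose F' : flow := fun q => F q + (if q == (i, j) then s else 0).
  have bF' : box F'.
    apply/boxP => a b; rewrite /F'; case: eqP => [[-> ->]//|_].
    by rewrite addr0; exact: FW.
  have := maxF _ bF'.
  have pick a b : (if (a, b) == (i, j) then s else 0) = (a == i)%:R * (b == j)%:R * s.
    by rewrite xpair_eqE; do 2 case: eqP => _; rewrite ?mul0r ?mul1r ?mulr0 ?mul0r.
  have sum1 (T : finType) (k : T) (f : T -> R) : \sum_a (a == k)%:R * f a = f k.
    rewrite (bigD1 k)//= eqxx mul1r big1 ?addr0// => a /negbTE ->.
    by rewrite mul0r.
  have cE : cost F' = cost F + s * c i j.
    rewrite /cost -(sum1 _ i (fun a => s * c a j)) -big_split; apply: eq_bigr => a _ /=.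
    rewrite -(sum1 _ j (fun b => s * c a b)) mulr_sumr -big_split; apply: eq_bigr => b _ /=.
    by rewrite /F' pick; ring.
  have exE k : excess F' k = excess F k + s * e k.
    rewrite /excess /F' !big_split/= /e.
    under [X in _ + X - _]eq_bigr do rewrite pick mulrAC mulrC.
    under [X in _ - (_ + X)]eq_bigr do rewrite pick -mulrA.
    by rewrite !sum1; ring.
  have dE : defect F' <= defect F + 2 * s * (excess F i - excess F j) + 2 * s ^+ 2.
    rewrite /defect -(sum1 _ i (fun a => excess F a)) -(sum1 _ j (fun a => excess F a)).
    rewrite -sumrB mulr_sumr -big_split.
    have -> : 2 * s ^+ 2 = \sum_k ((k == i)%:R * s ^+ 2 + (k == j)%:R * s ^+ 2).
      by rewrite big_split/= (sum1 _ i (fun=> s ^+ 2)) (sum1 _ j (fun=> s ^+ 2)); ring.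
    rewrite -big_split; apply: ler_sum => k _ /=; rewrite exE /e.
    by have := sqr_ge0 s; do 2 case: (k == _); rewrite /= ?mulr1n ?mulr0n; nra.
  rewrite /val cE => H.
  have {}dE : (2 * mu)^-1 * defect F' <=
    (2 * mu)^-1 * (defect F + 2 * s * (excess F i - excess F j) + 2 * s ^+ 2).
    by rewrite ler_wpM2l// invr_ge0; lra.
  have E : (2 * mu)^-1 * (defect F + 2 * s * (excess F i - excess F j) + 2 * s ^+ 2) =
    (2 * mu)^-1 * defect F + s * (r i - r j) + s ^+ 2 / mu.
    by rewrite /r; field; lra.
  by rewrite /g; lra.
have slack i j : W i j * Num.max 0 (g i j) = F (i, j) * g i j.
  have /andP[F0 F1] := FW i j.
  have sat : 0 < g i j -> F (i, j) = W i j.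
    move=> g0; apply: le_anti; rewrite F1 leNgt/=; apply/negP => F2.
    (* A push of size [s <= mu g / 2] would contradict [step], which forces [g <= s / mu]. *)
    pose s := Num.min (W i j - F (i, j)) (mu * g i j / 2).
    have s0 : 0 < s by rewrite lt_min subr_gt0 F2/= divr_gt0// mulr_gt0.
    have s1 : s <= W i j - F (i, j) by rewrite ge_min lexx.
    have s2 : s <= mu * g i j / 2 by rewrite ge_min lexx orbT.
    have /step : 0 <= F (i, j) + s <= W i j by apply/andP; split; lra.
    rewrite ler_pdivlMr// expr2 -mulrA ler_pM2l// [g i j * mu]mulrC.
    by have := mulr_gt0 mu0 g0; lra.
  have null : g i j < 0 -> F (i, j) = 0.
    move=> g0; apply: le_anti; rewrite F0 andbT leNgt/=; apply/negP => F2.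
    pose s := Num.min (F (i, j)) (mu * - g i j / 2).
    have s0 : 0 < s by rewrite lt_min F2/= divr_gt0// mulr_gt0// oppr_gt0.
    have s1 : s <= F (i, j) by rewrite ge_min lexx.
    have s2 : s <= mu * - g i j / 2 by rewrite ge_min lexx orbT.
    have /step : 0 <= F (i, j) + - s <= W i j by apply/andP; split; lra.
    rewrite ler_pdivlMr// sqrrN expr2 mulNr -mulrN -mulrA ler_pM2l// [_ * mu]mulrC.
    by have : 0 < mu * - g i j by [rewrite mulr_gt0// oppr_gt0]; lra.
  have [g0|g0|g0] := ltrgtP 0 (g i j).
  - by rewrite sat.
  - by rewrite null// mulr0 mul0r.
  - by rewrite -g0 !mulr0.
have -> : \sum_i \sum_j W i j * Num.max 0 (c i j - r i + r j) =
    cost F - mu^-1 * defect F.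
  under eq_bigr => i _ do under eq_bigr => j _ do rewrite slack.
  rewrite /cost /defect mulr_sumr -sumrB.
  have -> : \sum_i \sum_j F (i, j) * g i j =
      \sum_i \sum_j F (i, j) * c i j - \sum_i \sum_j F (i, j) * r i
      + \sum_i \sum_j F (i, j) * r j.
    rewrite -sumrB -big_split; apply: eq_bigr => i _ /=.
    by rewrite -sumrB -big_split; apply: eq_bigr => j _ /=; rewrite /g; ring.
  rewrite [X in _ + X]exchange_big/= -sumrB -big_split; apply: eq_bigr => i _ /=.
  by rewrite -!mulr_suml /r /excess; field; lra.
have dF : defect F <= 2 * mu * C.
  have := maxF _ box0.
  have -> : val (fun=> 0) = 0.
    rewrite /val /cost /defect /excess big1 => [|i _]; last by rewrite big1// => j _; rewrite mul0r.
    by rewrite big1 ?mulr0 ?subr0// => i _; rewrite subrr expr0n.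
  rewrite /val subr_ge0 ler_pdivrMl; last by lra.
  move=> /le_trans; apply; rewrite ler_wpM2l//; first by lra.
  apply: ler_sum => i _; apply: ler_sum => j _; rewrite ler_wpM2r//.
  by have /andP[] := FW i j.
apply: le_trans (ltW (gap _ bF (le_lt_trans dF muC))).
by rewrite gerBl mulr_ge0// invr_ge0 ltW.
Qed.

End Duality.

(** * Well-separated sets *)

(** Allows additive constants to be absorbed into multiples of [sqrt (ln n)]. *)
Lemma sqrt_ln_ge (R : realType) (n : nat) :
  (1 < n)%N -> 2^-1 <= Num.sqrt (ln (n%:R : R)).
Proof.
move=> n1; have n0 : (0 < n)%N by exact: ltnW.
have ln4 : 4^-1 <= ln (n%:R : R).
  apply: (@le_trans _ _ (ln 2)); last by rewrite ler_ln ?posrE ?ltr0n// ler_nat.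
  rewrite -ler_expR lnK ?posrE//; apply: le_trans (expR_le_inv _) _; first by lra.
  by rewrite -[leLHS]mul1r ler_pdivrMr; lra.
have ln0 : 0 <= ln (n%:R : R) by lra.
rewrite -ler_sqr ?nnegrE ?sqrtr_ge0 ?invr_ge0// sqr_sqrtr//.
by rewrite (_ : 2^-1 ^+ 2 = 4^-1)//; field.
Qed.

Section Separation.
Variables (R : realType) (I : finType) (N : nat) (x : I -> nat -> R) (p : I -> R).

Definition dif i j k : R := x j k - x i k.
Definition dist2 i j : R := nsq N (dif i j).

Lemma dist2C i j : dist2 i j = dist2 j i.
Proof. by apply: eq_bigr => k _; rewrite /dif -opprB sqrrN. Qed.

Lemma dist2xx i : dist2 i i = 0.
Proof. by rewrite /dist2 /nsq big1// => k _; rewrite /dif subrr expr0n. Qed.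

Lemma ip_dif i j u : ip N (dif i j) u = ip N (x j) u - ip N (x i) u.
Proof. exact: ipBl. Qed.

(** Farthest in the direction [u], among the points of a [dist2]-ball; the default [i] lies in this
    ball when [rad] is nonnegative. *)
Definition farthest rad i u : I :=
  [arg max_(j > i | dist2 i j <= rad) ip N (dif i j) u]%O.
Definition reach rad i u : R := ip N (dif i (farthest rad i u)) u.

Lemma farthestP rad i u : 0 <= rad ->
  dist2 i (farthest rad i u) <= rad /\
  forall j, dist2 i j <= rad -> ip N (dif i j) u <= reach rad i u.
Proof.
move=> r0; rewrite /reach /farthest; case: arg_maxP; first by rewrite dist2xx.
by move=> j dj maxj; split=> // k dk; exact: maxj.
Qed.

Lemma reach_ge0 rad i u : 0 <= rad -> 0 <= reach rad i u.
Proof.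
move=> r0; have [_ /(_ i)] := farthestP i u r0.
by rewrite dist2xx ip_dif subrr; apply.
Qed.

(** A maximum of linear functionals has the maximising one, [dif i (farthest rad i u)], as
    subgradient, and its squared norm is at most [rad]. *)
Lemma reach_variance rad i : 0 <= rad ->
  Ex N (fun u => reach rad i u ^+ 2) - Ex N (reach rad i) ^+ 2 <= 2 * rad.
Proof.
move=> r0.
apply: le_trans (_ : 2 * Ex N (fun u => dist2 i (farthest rad i u)) <= _).
  apply: (@Ex_variance _ _ _ (fun u => dif i (farthest rad i u))) => u v.
  rewrite ipBr lerD2l lerN2.
  by have [_] := farthestP i v r0; apply; have [] := farthestP i u r0.
rewrite ler_pM2l// -[leRHS](Ex_cst N); apply: le_Ex => u.
by have [] := farthestP i u r0.
Qed.

(** The usual maximal inequality: Jensen for [expR], a maximum bounded by the sum over at most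
    [#|I|] points, and the subgaussian bound for each of them. *)
Lemma reach_mean rad t i : 0 <= rad -> 0 < t ->
  Ex N (reach rad i) <= t^-1 * ln #|I|%:R + 2 * t * rad.
Proof.
move=> r0 t0; set a := Ex N (reach rad i).
have I0 : (0 < #|I|)%N by apply/card_gt0P; exists i.
suff : expR (t * a) <= expR (ln #|I|%:R + 2 * t ^+ 2 * rad).
  rewrite ler_expR mulrC -ler_pdivlMr// => /le_trans; apply.
  rewrite le_eqVlt; apply/orP; left; apply/eqP; field; lra.
rewrite expRD lnK ?posrE ?ltr0n//.
apply: le_trans (_ : Ex N (fun u => expR (t * reach rad i u)) <= _).
  (* Jensen's inequality through the tangent line of the exponential at [t * a]. *)
  apply: le_trans (_ : Ex N (fun u => expR (t * a) * (1 + t * (reach rad i u - a))) <= _).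
    by rewrite ExZ ExD Ex_cst ExZ ExB Ex_cst -/a subrr mulr0 addr0 mulr1.
  apply: le_Ex => u.
  rewrite (_ : t * reach rad i u = t * a + t * (reach rad i u - a)); last by ring.
  by rewrite expRD ler_pM2l ?expR_gt0// expR_ge1Dx.
apply: le_trans (_ : \sum_(j | dist2 i j <= rad)
    Ex N (fun u => expR (ip N (fun k => t * dif i j k) u)) <= _).
  rewrite -Ex_sum; apply: le_Ex => u.
  have [dj _] := farthestP i u r0.
  rewrite (bigD1 (farthest rad i u))//= ipZl lerDl.
  by apply: sumr_ge0 => j _; exact: expR_ge0.
apply: le_trans (_ : \sum_(j | dist2 i j <= rad) expR (2 * t ^+ 2 * rad) <= _).
  apply: ler_sum => j dj; apply: le_trans (Ex_expR_ip _ _) _.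
  by rewrite ler_expR nsqZ mulrA ler_wpM2l// mulr_ge0 ?sqr_ge0.
rewrite sumr_const -[leLHS]mulr_natl ler_wpM2r ?expR_ge0// ler_nat.
exact: max_card.
Qed.

Hypothesis p0 : forall i, 0 <= p i.
Hypothesis p1 : \sum_i p i = 1.
Hypothesis dtri : forall i j k, dist2 i j <= dist2 i k + dist2 k j.

(** Go from [i] to [j], then to the point farthest from [j]. The triangle inequality for squared
    distances makes the radii add up linearly in the number of steps. *)
Lemma reach_step rad Delta i j u : 0 <= rad -> 0 <= Delta -> dist2 i j <= Delta ->
  ip N (dif i j) u + reach rad j u <= reach (rad + Delta) i u.
Proof.
move=> r0 D0 dij; have [dj _] := farthestP j u r0.
have [_ /(_ (farthest rad j u)) h] := farthestP i u (addr_ge0 r0 D0).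
rewrite {1}/reach; set l := farthest rad j u in dj h *.
apply: (@le_trans _ _ (ip N (dif i l) u)).
- by rewrite !ip_dif; lra.
- by apply: h; have := dtri i l j; lra.
Qed.

(** Two values [2 sg] apart cannot both lie within [sg] of the median, so the two tails beyond [sg]
    have total mass at least [q / 2]. The heavier tail is paired with the half of the mass on the
    other side of the median. *)
Lemma projection_split (X : I -> R) sg :
  let q := \sum_i \sum_j p i * p j * (2 * sg <= `|X i - X j|)%R%:R in
  exists L B : pred I, [/\ q / 4 <= \sum_(i | L i) p i, q / 4 <= \sum_(i | B i) p i
    & forall i j, L i -> B j -> X i + sg <= X j].
Proof.
move=> q.
have [m [m1 m2]] := weighted_median X predT p0.
rewrite p1 in m1 m2.
have q1 : q <= 1.
  rewrite -p1 -[leRHS]mulr1 -p1 mulr_suml; apply: ler_sum => i _.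
  rewrite mulr_sumr; apply: ler_sum => j _.
  by rewrite -[leRHS]mulr1 ler_wpM2l ?mulr_ge0// lern1 leq_b1.
have qm : q <= 2 * (\sum_(i | X i <= m - sg) p i + \sum_(i | m + sg <= X i) p i).
  pose a i : R := (X i <= m - sg)%R%:R + (m + sg <= X i)%R%:R.
  have aE : \sum_i p i * a i = \sum_(i | X i <= m - sg) p i + \sum_(i | m + sg <= X i) p i.
    rewrite [X in _ = X + _]big_mkcond [X in _ = _ + X]big_mkcond -big_split.
    apply: eq_bigr => i _; rewrite /a /= mulrDr.
    by congr (_ + _); case: ifP; rewrite ?mulr1 ?mulr0.
  rewrite -aE; apply: le_trans (_ : _ <= \sum_i \sum_j (p i * a i * p j + p i * (p j * a j))) _.
    apply: ler_sum => i _; apply: ler_sum => j _.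
    rewrite (_ : _ + _ = p i * p j * (a i + a j)); last by ring.
    rewrite ler_wpM2l ?mulr_ge0//.
    have [h|_] := lerP (2 * sg) `|X i - X j|; last by rewrite /a !addr_ge0 ?ler0n.
    have : [|| X i <= m - sg, m + sg <= X i, X j <= m - sg | m + sg <= X j].
      apply/negP => /negP; rewrite !negb_or -!ltNge => /and4P[? ? ? ?].
      by move: h; rewrite leNgt ltr_norml => /negP; apply; apply/andP; split; lra.
    rewrite /a; have B0 (b : bool) : 0 <= b%:R :> R by rewrite ler0n.
    case/or4P => ->; rewrite mulr1n;
      have := B0 (X i <= m - sg); have := B0 (m + sg <= X i);
      have := B0 (X j <= m - sg); have := B0 (m + sg <= X j); lra.
  rewrite mulr_natl mulr2n; under eq_bigr do rewrite big_split/= -!mulr_sumr p1 mulr1.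
  by rewrite big_split/= -mulr_suml p1 mul1r.
have m1' : 1 / 2 <= \sum_(i | X i <= m) p i by [].
have m2' : 1 / 2 <= \sum_(i | m <= X i) p i by [].
have [H|H] := lerP (q / 4) (\sum_(i | m + sg <= X i) p i).
  exists (fun i => X i <= m), (fun i => m + sg <= X i); split=> //; first by lra.
  by move=> i j; lra.
exists (fun i => X i <= m - sg), (fun i => m <= X i); split=> //; [lra|lra|].
by move=> i j; lra.
Qed.

(** * Stretched matchings in the absence of separated sets *)

Section Failure.
Variables (Delta c sg : R).
Hypothesis D0 : 0 <= Delta.

Definition stretched (m : I -> I -> R) u : Prop :=
  [/\ forall i j, 0 <= m i j,
      forall i j, m i j != 0 -> dist2 i j <= Delta /\ sg <= ip N (dif i j) u,
      forall i, \sum_j m i j <= p i,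
      forall j, \sum_i m i j <= p j
    & (\sum_i \sum_j p i * p j * (2 * sg <= `|ip N (dif i j) u|)%R%:R) / 4 - c <=
      \sum_i \sum_j m i j].

(** Match greedily between the two sets of [projection_split]. If the mass fell short, the
    unsaturated points on each side would have mass at least [c], hence contain a close pair,
    against maximality. *)
Lemma stretched_matching u : (forall L B : pred I,
    c <= \sum_(i | L i) p i -> c <= \sum_(i | B i) p i ->
    exists i j, [/\ L i, B j & dist2 i j <= Delta]) ->
  exists m, stretched m u.
Proof.
move=> no_sep; have [L [B]] := projection_split (fun i => ip N (x i) u) sg.
set q := \sum_i _; move=> [qL qB LB].
have qE : \sum_i \sum_j p i * p j * (2 * sg <= `|ip N (dif i j) u|)%R%:R = q.
  apply: eq_bigr => i _; apply: eq_bigr => j _.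
  by rewrite ip_dif distrC.
pose al i := if L i then p i else 0; pose be i := if B i then p i else 0.
have al0 i : 0 <= al i by rewrite /al; case: ifP.
have be0 i : 0 <= be i by rewrite /be; case: ifP.
have [m [m0 mQ ma mb ms]] := @greedy_matching _ _ al be
  (fun i j => [&& L i, B j & dist2 i j <= Delta]) al0 be0.
exists m; split=> //.
- move=> i j /mQ /and3P[Li Bj dij]; split=> //.
  by rewrite ip_dif; have := LB _ _ Li Bj; lra.
- by move=> i; apply: le_trans (ma i) _; rewrite /al; case: ifP.
- by move=> i; apply: le_trans (mb i) _; rewrite /be; case: ifP.
rewrite qE leNgt; apply/negP => Mq.
pose L' i := L i && (\sum_j m i j != p i); pose B' j := B j && (\sum_i m i j != p j).
have cL' : c <= \sum_(i | L' i) p i.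
  suff : \sum_(i | L i) p i <= \sum_i \sum_j m i j + \sum_(i | L' i) p i by lra.
  rewrite (bigID (fun i => \sum_j m i j != p i))/= addrC lerD2r [leLHS]big_mkcond/=.
  apply: ler_sum => i _; case: ifP => [/andP[_]|_]; last by apply: sumr_ge0.
  by rewrite negbK => /eqP ->.
have cB' : c <= \sum_(i | B' i) p i.
  suff : \sum_(i | B i) p i <= \sum_i \sum_j m i j + \sum_(i | B' i) p i by lra.
  rewrite exchange_big/= (bigID (fun j => \sum_i m i j != p j))/= addrC lerD2r.
  rewrite [leLHS]big_mkcond/=.
  apply: ler_sum => i _; case: ifP => [/andP[_]|_]; last by apply: sumr_ge0.
  by rewrite negbK => /eqP ->.
have [i [j [/andP[Li /eqP Ni] /andP[Bj /eqP Nj] dij]]] := no_sep _ _ cL' cB'.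
have := ms i j; rewrite Li Bj dij /al /be Li Bj => /(_ isT).
by case.
Qed.

(* Chaining: along a matched pair [(i, j)] the reach from [i] exceeds the reach
   from [j] by [sg], and dually for [- u]. Replacing reaches by their means costs
   only their standard deviation, and the sum over the [K] scales telescopes. *)
Lemma chaining m (K : nat) (tau bnd : R) : (forall u, stretched (m u) u) ->
  0 < tau -> 2 * (K%:R * Delta) <= tau ^+ 2 ->
  (forall i, Ex N (reach (K%:R * Delta) i) <= bnd) ->
  forall q0 : R, q0 <= Ex N (fun u => \sum_i \sum_j p i * p j *
                     (2 * sg <= `|ip N (dif i j) u|)%R%:R) ->
  0 <= sg ->
  2 * sg * K%:R * (q0 / 4 - c) <= 2 * bnd + 4 * K%:R * tau.
Proof.
move=> mP tau0 Ktau Gbnd q0 q0E sg0.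
(* Adds the reach inequality at [i] for [u] to the one at [j] for [- u], and trades each reach [f]
   for its mean [g] at the price of [|f - g|]. *)
have gain (a f1 f2 f3 f4 g1 g2 g3 g4 : R) : sg <= a ->
    a + f1 <= f2 -> a + f3 <= f4 ->
    2 * sg <= (g2 + g4) - (g3 + g1) + (`|f2 - g2| + `|f3 - g3| + (`|f4 - g4| + `|f1 - g1|)).
  have := ler_norm (f2 - g2); have := ler_norm (f4 - g4).
  have := ler_norm (- (f1 - g1)); have := ler_norm (- (f3 - g3)); rewrite !normrN.
  by lra.
have ends (a b g h : R) : 0 <= g -> 0 <= h -> a <= bnd -> b <= bnd ->
    (a + b) - (g + h) <= 2 * bnd by lra.
have tau2 (a b : R) : a <= tau -> b <= tau -> a + b <= 2 * tau by lra.
have tau4 : 4 * tau = 2 * tau + 2 * tau by lra.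
have sumK (a : R) : \sum_(k < K) a = K%:R * a.
  by rewrite sumr_const card_ord mulr_natl.
pose f k := reach (k%:R * Delta).
pose G k i := Ex N (f k i).
pose dev k i u : R := `|f k i u - G k i|.
pose neg (u : nat -> R) := fun k => - u k.
pose M u := \sum_i \sum_j m u i j.
have rad0 k : 0 <= k%:R * Delta by rewrite mulr_ge0.
have bnd0 (i : I) : 0 <= bnd.
  apply: le_trans (Gbnd i); rewrite -(Ex_cst N 0); apply: le_Ex => u.
  exact: reach_ge0.
have fS k i j u : dist2 i j <= Delta -> ip N (dif i j) u + f k j u <= f k.+1 i u.
  move=> dij; rewrite /f -natr1 mulrDl mul1r; exact: reach_step.
pose Err k u := \sum_i p i * (dev k.+1 i u + dev k i (neg u)) +
              \sum_i p i * (dev k.+1 i (neg u) + dev k i u).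
have H1 k u : 2 * sg * M u <= \sum_i \sum_j m u i j *
    ((G k.+1 i + G k.+1 j) - (G k i + G k j)) + Err k u.
  have [m0 mQ mr mc _] := mP u.
  have rowS (g : I -> R) : (forall i, 0 <= g i) ->
      \sum_i \sum_j m u i j * g i <= \sum_i p i * g i.
    by move=> g0; apply: ler_sum => i _; rewrite -mulr_suml ler_wpM2r.
  have colS (g : I -> R) : (forall i, 0 <= g i) ->
      \sum_i \sum_j m u i j * g j <= \sum_i p i * g i.
    move=> g0; rewrite exchange_big/=; apply: ler_sum => i _.
    by rewrite -mulr_suml ler_wpM2r.
  apply: le_trans (_ : \sum_i \sum_j (m u i j * ((G k.+1 i + G k.+1 j) - (G k i + G k j))
     + (m u i j * (dev k.+1 i u + dev k i (neg u)) +
        m u i j * (dev k.+1 j (neg u) + dev k j u))) <= _).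
    rewrite /M mulr_sumr; apply: ler_sum => i _; rewrite mulr_sumr.
    apply: ler_sum => j _; rewrite -!mulrDr mulrC.
    have [->|mij] := eqVneq (m u i j) 0; first by rewrite !mul0r.
    have [dij sij] := mQ _ _ mij; rewrite ler_wpM2l//.
    have := fS k i j u dij; have := fS k j i (neg u).
    rewrite dist2C ipNr => /(_ dij).
    have -> : ip N (dif j i) u = - ip N (dif i j) u by rewrite !ip_dif opprB.
    by rewrite opprK => h1 h2; exact: (gain _ _ _ _ _ _ _ _ _ sij h2 h1).
  under eq_bigr do rewrite big_split/=; rewrite big_split/= lerD2l /Err.
  under eq_bigr do rewrite big_split/=; rewrite big_split/=.
  by apply: lerD; [apply: (rowS (fun i => _))|apply: (colS (fun i => _))] => i;
    rewrite addr_ge0// normr_ge0.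
(* The means telescope to scale [K] minus scale [0], for a matching of total mass at most [1]. *)
have H2 u : 2 * sg * K%:R * M u <= 2 * bnd + \sum_(k < K) Err k u.
  have [m0 _ mr _ _] := mP u.
  have : \sum_(k < K) 2 * sg * M u <= \sum_(k < K) (\sum_i \sum_j m u i j *
    ((G k.+1 i + G k.+1 j) - (G k i + G k j)) + Err k u).
    by apply: ler_sum => k _; exact: H1.
  rewrite sumK mulrCA mulrA => /le_trans; apply.
  rewrite big_split/= lerD2r exchange_big/=.
  under eq_bigr do rewrite exchange_big/=.
  apply: le_trans (_ : \sum_i \sum_j m u i j * (2 * bnd) <= _).
    apply: ler_sum => i _; apply: ler_sum => j _; rewrite -mulr_sumr ler_wpM2l//.
    rewrite -(big_mkord xpredT (fun k => (G k.+1 i + G k.+1 j) - (G k i + G k j))).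
    rewrite (telescope_sumr (fun k => G k i + G k j))//.
    have G0 l : 0 <= G 0%N l.
      by rewrite -(Ex_cst N 0); apply: le_Ex => v; exact: reach_ge0.
    by apply: ends => //; exact: Gbnd.
  under eq_bigr do rewrite -mulr_suml.
  rewrite -mulr_suml.
  have [/existsP[i _]|I0] := boolP [exists i : I, true]; last first.
    by move: p1; rewrite big1 => [/esym/eqP|i _]; [rewrite oner_eq0|case/existsP: I0; exists i].
  rewrite -[leRHS]mul1r ler_wpM2r//; first by rewrite mulr_ge0// (bnd0 i).
  by rewrite -p1; apply: ler_sum.
have devE k i : (k <= K)%N -> Ex N (dev k i) <= tau.
  move=> kK; apply: (@Ex_abs_dev _ _ _ (2 * (k%:R * Delta))) => //.
    exact: reach_variance.
  apply: le_trans Ktau; rewrite ler_pM2l// ler_wpM2r// ler_nat//.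
have ES k : (k < K)%N -> Ex N (Err k) <= 4 * tau.
  move=> kK; rewrite /Err ExD !Ex_sum.
  have E1 (g h : (nat -> R) -> R) : Ex N g <= tau -> Ex N h <= tau ->
      Ex N (fun u => g u + h u) <= 2 * tau by rewrite ExD; exact: tau2.
  have E2 (g : I -> (nat -> R) -> R) : (forall i, Ex N (g i) <= 2 * tau) ->
      \sum_i Ex N (fun u => p i * g i u) <= 2 * tau.
    move=> gE; rewrite -[leRHS]mul1r -[X in X * (2 * tau)]p1 mulr_suml; apply: ler_sum => i _.
    by rewrite ExZ; apply: ler_wpM2l; [exact: p0|exact: gE].
  have EN l i : Ex N (fun u => dev l i (neg u)) = Ex N (dev l i) := ExN N (dev l i).
  rewrite tau4; apply: lerD.
    apply: (E2 (fun i u => dev k.+1 i u + dev k i (neg u))) => i.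
    apply: (E1 (dev k.+1 i) (fun u => dev k i (neg u))); first exact: devE.
    by rewrite EN; exact: devE (ltnW kK).
  apply: (E2 (fun i u => dev k.+1 i (neg u) + dev k i u)) => i.
  apply: (E1 (fun u => dev k.+1 i (neg u)) (dev k i)); last exact: devE (ltnW kK).
  by rewrite EN; exact: devE.
have EM : q0 / 4 - c <= Ex N M.
  apply: le_trans (_ : Ex N (fun u => (\sum_i \sum_j p i * p j *
     (2 * sg <= `|ip N (dif i j) u|)%R%:R) * 4^-1 - c) <= _).
    rewrite ExB Ex_cst lerD2r.
    under eq_Ex => u do rewrite mulrC.
    by rewrite ExZ mulrC ler_wpM2l.
  by apply: le_Ex => u; have [] := mP u.
apply: le_trans (_ : Ex N (fun u => 2 * sg * K%:R * M u) <= _).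
  by rewrite ExZ ler_wpM2l// !mulr_ge0.
apply: le_trans (le_Ex N H2) _.
rewrite ExD Ex_cst lerD2l Ex_sum.
apply: le_trans (_ : \sum_(k < K) 4 * tau <= _).
  by apply: ler_sum => k _; exact: ES.
by rewrite sumK mulrCA mulrA.
Qed.

End Failure.

Hypothesis spread : 3 / 4 <= \sum_i \sum_j p i * p j * (4^-1 < dist2 i j)%R%:R.

(** A pair with [dist2 > 1/4] has squared projection at least [dist2 / 4 > 1/16] with probability at
    least [1/5], and [3/4 * 1/5 = 3/20]. *)
Lemma Ex_spread : 3 / 20 <=
  Ex N (fun u => \sum_i \sum_j p i * p j * (2 * 8^-1 <= `|ip N (dif i j) u|)%R%:R).
Proof.
rewrite Ex_sum; under eq_bigr do rewrite Ex_sum.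
apply: le_trans (_ : (\sum_i \sum_j p i * p j * (4^-1 < dist2 i j)%R%:R) * 5^-1 <= _).
  by rewrite ler_pdivlMr//; apply: le_trans spread; lra.
rewrite mulr_suml; apply: ler_sum => i _; rewrite mulr_suml; apply: ler_sum => j _.
rewrite ExZ -mulrA ler_wpM2l ?mulr_ge0//.
have [dij|_] := ltrP 4^-1 (dist2 i j); last first.
  by rewrite mul0r -(Ex_cst N 0); apply: le_Ex => u; rewrite ler0n.
rewrite mul1r; apply: le_trans (Ex_ip_large _) _.
  by apply: lt_trans dij; rewrite invr_gt0.
apply: le_Ex => u; rewrite -/(dist2 i j) ler_nat.
have [h|//] := lerP (dist2 i j / 4) (ip N (dif i j) u ^+ 2).
suff -> : 2 * 8^-1 <= `|ip N (dif i j) u| by [].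
rewrite -ler_sqr ?nnegrE ?normr_ge0 ?mulr_ge0// real_normK ?num_real//.
by apply: le_trans h; lra.
Qed.

(** This is [tau^2 / 2] over the factor in [K <= (32 * 40 + 2) s], for the [tau], [K] and [s] of
    [separated_sets]. *)
Definition sep_const : R := (32 * 40) ^- 2 / 2 / (32 * 40 + 2).

Lemma sep_const_gt0 : 0 < sep_const.
Proof. by rewrite !divr_gt0 ?invr_gt0 ?exprn_gt0 ?mulr_gt0 ?addr_gt0 ?mulr_gt0. Qed.

Lemma separated_sets : (1 < #|I|)%N -> exists L B : pred I,
  [/\ 80^-1 <= \sum_(i | L i) p i, 80^-1 <= \sum_(i | B i) p i
    & forall i j, L i -> B j -> sep_const / Num.sqrt (ln #|I|%:R) <= dist2 i j].
Proof.
move=> I1; set s := Num.sqrt _.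
have I0 : (0 < #|I|)%N by exact: ltnW.
have s2 : s ^+ 2 = ln #|I|%:R by rewrite sqr_sqrtr// ln_ge0// ler1n.
have s12 : 2^-1 <= s := sqrt_ln_ge R I1.
clearbody s.
(* With [sg = 1/8], [c = 1/80] and [q0 = 3/20], [chaining] reads [K / 160 <= 4 s + 4 K tau]. This
   [tau] makes the last term [K / 320], so [K > 32 * 40 * s] is a contradiction. *)
set tau : R := (32 * 40)^-1.
have tau0 : 0 < tau by rewrite invr_gt0; lra.
have tau1 : tau * (32 * 40) = 1 by rewrite mulVf//; lra.
pose K := (Num.truncn (32 * 40 * s)).+1.
have K1 : 32 * 40 * s < K%:R by exact: truncnS_gt.
have K2 : K%:R <= (32 * 40 + 2) * s.
  have : (Num.truncn (32 * 40 * s))%:R <= 32 * 40 * s by rewrite truncn_le//; lra.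
  by rewrite /K -natr1; lra.
have K0 : 0 < K%:R :> R by rewrite ltr0n.
pose Delta := tau ^+ 2 / 2 / K%:R.
have tt0 : 0 <= tau ^+ 2 / 2 by rewrite divr_ge0// sqr_ge0.
have D0 : 0 <= Delta by rewrite divr_ge0.
have KD : K%:R * Delta = tau ^+ 2 / 2 by rewrite /Delta mulrC divfK// gt_eqF.
apply: contrapT => no.
have no_sep (L B : pred I) : 80^-1 <= \sum_(i | L i) p i -> 80^-1 <= \sum_(i | B i) p i ->
    exists i j, [/\ L i, B j & dist2 i j <= Delta].
  move=> cL cB; apply: contrapT => sep; apply: no; exists L, B; split=> // i j Li Bj.
  have [dij|dij] := lerP (dist2 i j) Delta; first by case: sep; exists i, j.
  apply: le_trans (ltW dij); rewrite /Delta /sep_const -exprVn -/tau -[leLHS]mulrA ler_wpM2l//.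
  by rewrite -invfM lef_pV2// posrE; lra.
(* The choice [t = s] in [reach_mean] gives [s + s tau^2]. *)
have B1 i : Ex N (reach (K%:R * Delta) i) <= 2 * s.
  rewrite KD; apply: le_trans (@reach_mean _ s i tt0 _) _; first by lra.
  rewrite -s2 (_ : s^-1 * s ^+ 2 = s); last by field; lra.
  rewrite (_ : 2 * s * (tau ^+ 2 / 2) = s * tau ^+ 2); last by field.
  suff : s * tau ^+ 2 <= s * 1 by lra.
  rewrite ler_wpM2l//; first by lra.
  by rewrite expr_le1//; lra.
have V1 : 2 * (K%:R * Delta) <= tau ^+ 2 by rewrite KD; lra.
have no_matching m : ~ forall u, stretched Delta 80^-1 8^-1 (m u) u.
  move=> mP; have := chaining D0 mP tau0 V1 B1 Ex_spread.
  have -> : 4 * K%:R * tau = K%:R / 320 by rewrite /tau; field.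
  by move: (K%:R : R) K1 => k K1; lra.
have [m mP] := choice (fun u => @stretched_matching Delta 80^-1 8^-1 u no_sep).
exact: no_matching mP.
Qed.

End Separation.

(** * Directed edge expansion *)

Section DirectedGraph.
Variables (R : realType) (n : nat) (E : rel 'I_n) (w : 'I_n -> 'I_n -> R).
Variable pi : 'I_n -> R.
Hypothesis n1 : (1 < n)%N.
Hypothesis w_gt0 : forall i j, E i j -> 0 < w i j.
Hypothesis pi_gt0 : forall i, 0 < pi i.

Definition edgew i j : R := if E i j then w i j else 0.

Lemma edgew_ge0 i j : 0 <= edgew i j.
Proof. by rewrite /edgew; case: ifP => // /w_gt0/ltW. Qed.

Lemma wout_cut (S : {set 'I_n}) : wout E w S = cut edgew (fun i => i \in S).
Proof.
apply: eq_bigr => i _; rewrite big_mkcondr/=; apply: eq_bigl => j.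
by rewrite inE.
Qed.

Lemma cut_ge0 (A : pred 'I_n) : 0 <= cut edgew A.
Proof. by apply: sumr_ge0 => i _; apply: sumr_ge0 => j _; exact: edgew_ge0. Qed.

Lemma cut_setC (F : 'I_n -> 'I_n -> R) (S : {set 'I_n}) :
  cut F (fun i => i \in ~: S) = cut (fun i j => F j i) (fun i => i \in S).
Proof.
rewrite /cut exchange_big/=; apply: eq_big => [j|j _]; first by rewrite inE negbK.
by apply: eq_bigl => i; rewrite inE.
Qed.

Lemma sqn_ge0 (x : 'rV[R]_n) : 0 <= sqn x.
Proof. by apply: sumr_ge0 => k _; exact: sqr_ge0. Qed.

Lemma sqnBC (x y : 'rV[R]_n) : sqn (x - y) = sqn (y - x).
Proof. by apply: eq_bigr => k _; rewrite -opprB mxE sqrrN. Qed.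

Lemma energyE (F : 'I_n -> 'I_n -> R) v :
  energy F v = 2^-1 * (\sum_i \sum_j F i j * sqn (v i - v j)).
Proof.
have sqn0 i : sqn (v i - v i) = 0.
  by rewrite subrr /sqn big1// => k _; rewrite mxE expr0n.
have -> : \sum_i \sum_j F i j * sqn (v i - v j) =
    \sum_(i < n) \sum_(j < n | (i < j)%N) F i j * sqn (v i - v j) +
    \sum_(i < n) \sum_(j < n | (i < j)%N) F j i * sqn (v i - v j).
  have -> : \sum_(i < n) \sum_(j < n | (i < j)%N) F j i * sqn (v i - v j) =
      \sum_(i < n) \sum_(j < n | (j < i)%N) F i j * sqn (v i - v j).
    under eq_bigr do rewrite big_mkcond/=.
    rewrite exchange_big/=; apply: eq_bigr => i _; rewrite [RHS]big_mkcond/=.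
    by apply: eq_bigr => j _; rewrite sqnBC.
  rewrite -big_split/=; apply: eq_bigr => i _.
  rewrite [X in X + _]big_mkcond [X in _ + X]big_mkcond -big_split/=.
  apply: eq_bigr => j _; case: (ltngtP i j) => [_|_|/val_inj->].
  - by rewrite addr0.
  - by rewrite add0r.
  - by rewrite sqn0 mulr0 addr0.
rewrite -big_split/= mulr_sumr; apply: eq_bigr => i _.
rewrite -big_split/= mulr_sumr; apply: eq_bigr => j _.
by rewrite /=; ring.
Qed.

Lemma circ_bound F : is_circ E w F -> forall i j, 0 <= F i j <= edgew i j.
Proof.
move=> [F0 FE FW _] i j; rewrite F0/= /edgew; case: ifP => [/FW//|/negbT/FE ->].
exact: lexx.
Qed.

Lemma circ0 : is_circ E w (fun _ _ => 0).
Proof. by split=> // i j /w_gt0/ltW. Qed.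

(** Circulations are bounded by the edge weights, so the energies are bounded above and [sup] is a
    true supremum. *)
Lemma energy_le_sup F v : is_circ E w F ->
  energy F v <= sup [set y | exists F, is_circ E w F /\ y = energy F v]%classic.
Proof.
move=> cF; apply: ub_le_sup; last by exists F.
exists (2^-1 * \sum_i \sum_j edgew i j * sqn (v i - v j)) => _ [F' [cF' ->]].
rewrite energyE ler_pM2l ?invr_gt0//.
apply: ler_sum => i _; apply: ler_sum => j _; rewrite ler_wpM2r ?sqn_ge0//.
by have /andP[] := circ_bound cF' i j.
Qed.

Lemma sup_energy_ge0 v :
  0 <= sup [set y | exists F, is_circ E w F /\ y = energy F v]%classic.
Proof.
apply: le_trans (energy_le_sup v circ0); rewrite energyE.
by rewrite big1 ?mulr0// => i _; rewrite big1// => j _; rewrite mul0r.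
Qed.

Lemma piS_ge0 (S : {set 'I_n}) : 0 <= piS pi S.
Proof. by apply: sumr_ge0 => i _; exact: ltW. Qed.

Lemma piS_gt0 (S : {set 'I_n}) : S != finset.set0 -> 0 < piS pi S.
Proof.
move=> /set0Pn[i Si]; rewrite /piS (bigD1 i)//= ltr_pwDl//.
by apply: sumr_ge0 => j _; exact: ltW.
Qed.

Lemma setC_neq0 (S : {set 'I_n}) : S != [set: 'I_n]%SET -> ~: S != finset.set0.
Proof. by apply: contra => /eqP S0; rewrite -(finset.setCK S) S0 finset.setC0. Qed.

(** Sum the conservation law over [S]; the flow inside [S] cancels. *)
Lemma circ_cut F (S : {set 'I_n}) : is_circ E w F ->
  cut F (fun i => i \in S) = cut F (fun i => i \in ~: S).
Proof.
move=> [_ _ _ FC].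
have H : \sum_(i in S) \sum_j F i j = \sum_(i in S) \sum_j F j i.
  by apply: eq_bigr => i _; exact: FC.
have C1 : \sum_(i in S) \sum_j F i j =
    \sum_(i in S) \sum_(j in S) F i j + cut F (fun i => i \in S).
  by rewrite -big_split; apply: eq_bigr => i _; rewrite (bigID (mem S)).
have C2 : \sum_(i in S) \sum_j F j i =
    \sum_(i in S) \sum_(j in S) F i j + cut F (fun i => i \in ~: S).
  rewrite [X in _ = X + _]exchange_big cut_setC /cut/=.
  by rewrite -big_split; apply: eq_bigr => i _; rewrite (bigID (mem S)).
by move: H; rewrite C1 C2 => /addrI.
Qed.

Lemma cut_le F (A : pred 'I_n) : is_circ E w F -> cut F A <= cut edgew A.
Proof.
move=> cF; apply: ler_sum => i _; apply: ler_sum => j _.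
by have /andP[] := circ_bound cF i j.
Qed.

(** * Two-valued vectors from cuts *)

Definition line_embedding (x : 'I_n -> R) (i : 'I_n) : 'rV[R]_n :=
  \row_k (if k == Ordinal (ltnW n1) then x i else 0).

Lemma sqn_line (a : R) :
  sqn (\row_k (if k == Ordinal (ltnW n1) then a else 0)) = a ^+ 2.
Proof.
rewrite /sqn (bigD1 (Ordinal (ltnW n1)))//= mxE eqxx big1 ?addr0// => k /negbTE k0.
by rewrite mxE k0 expr0n.
Qed.

Lemma sqn_lineB x i j : sqn (line_embedding x i - line_embedding x j) = (x i - x j) ^+ 2.
Proof.
rewrite -sqn_line; congr sqn; apply/rowP => k; rewrite !mxE.
by case: ifP => _; rewrite ?subr0.
Qed.

(** The values [t g] on [S] and [- s g] off [S] are centred, and [g] normalises them. Only the cut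
    contributes energy, equally in both directions, with squared distance
    [1 / s + 1 / t <= 2 / min (s, t)]. *)
Lemma cut_vector (S : {set 'I_n}) : S != finset.set0 -> S != [set: 'I_n]%SET ->
  exists v, feasible pi v /\
    forall F, is_circ E w F -> energy F v <= 2 * dir_exp_set E w pi S.
Proof.
move=> S0 ST; set s := piS pi S; set t := piS pi (~: S).
have s0 : 0 < s by exact: piS_gt0.
have t0 : 0 < t by apply: piS_gt0; exact: setC_neq0.
pose g := Num.sqrt (s * t * (s + t))^-1.
have g2 : g ^+ 2 = (s * t * (s + t))^-1.
  by rewrite sqr_sqrtr// invr_ge0 !mulr_ge0 ?addr_ge0// ltW.
pose x i := if i \in S then t * g else - s * g.
have sumS (f : 'I_n -> R) a b : (forall i, i \in S -> f i = a) ->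
    (forall i, i \notin S -> f i = b) -> \sum_i pi i * f i = s * a + t * b.
  move=> fa fb; rewrite (bigID (mem S))/= /s /t /piS !mulr_suml; congr (_ + _).
    by apply: eq_bigr => i /fa ->.
  by apply: eq_big => [i|i /fb -> //]; rewrite inE.
have d2 : (t * g - - s * g) ^+ 2 = (s + t) / (s * t).
  rewrite (_ : _ ^+ 2 = (s + t) ^+ 2 * g ^+ 2); last by ring.
  by rewrite g2; field; rewrite !gt_eqF// addr_gt0.
exists (line_embedding x); split.
  split.
  - apply/rowP => k; rewrite summxE !mxE.
    under eq_bigr do rewrite !mxE.
    case: (k == _) => /=; last by rewrite big1// => i _; rewrite mulr0.
    rewrite (sumS _ (t * g) (- s * g)); first by ring.
      by move=> i Si; rewrite /x Si.
    by move=> i /negbTE Si; rewrite /x Si.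
  - under eq_bigr do rewrite /line_embedding sqn_line.
    rewrite (sumS _ ((t * g) ^+ 2) ((- s * g) ^+ 2)).
    + rewrite !exprMn g2; field; rewrite !gt_eqF// addr_gt0//.
    + by move=> i Si; rewrite /x Si.
    + by move=> i /negbTE Si; rewrite /x Si.
  - move=> i j k; rewrite !sqn_lineB /x.
    have H (a b : R) : (a - b) ^+ 2 = (b - a) ^+ 2 by ring.
    case: (i \in S); case: (j \in S); case: (k \in S);
      by rewrite ?subrr ?expr0n/= ?addr0 ?add0r ?addr_ge0 ?sqr_ge0 ?lexx// H.
move=> F cF; rewrite energyE.
have -> : \sum_i \sum_j F i j * sqn (line_embedding x i - line_embedding x j) =
    (cut F (fun i => i \in S) + cut F (fun i => i \in ~: S)) * ((s + t) / (s * t)).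
  rewrite mulrDl (bigID (mem S))/=; congr (_ + _); rewrite mulr_suml.
    apply: eq_bigr => i Si; rewrite (bigID (mem S))/= big1 ?add0r => [|j Sj].
      rewrite mulr_suml; apply: eq_bigr => j /negbTE Sj.
      by rewrite sqn_lineB /x Si Sj d2.
    by rewrite sqn_lineB /x Si Sj subrr expr0n mulr0.
  apply: eq_big => [i|i /negbTE Si]; first by rewrite inE.
  rewrite (bigID (mem S))/= [X in _ + X]big1 ?addr0 => [|j /negbTE Sj].
    rewrite mulr_suml; apply: eq_big => [j|j Sj]; first by rewrite inE negbK.
    by rewrite sqn_lineB /x Si Sj -d2; ring.
  by rewrite sqn_lineB /x Si Sj subrr expr0n mulr0.
rewrite /dir_exp_set -/s -/t !wout_cut.
set m := Num.min (cut _ _) _.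
have Fm : cut F (fun i => i \in S) <= m by rewrite le_min cut_le//= (circ_cut _ cF) cut_le.
rewrite -(circ_cut _ cF).
have F0 : 0 <= cut F (fun i => i \in S).
  apply: sumr_ge0 => i _; apply: sumr_ge0 => j _.
  by have /andP[] := circ_bound cF i j.
have st : (s + t) / (s * t) <= 2 / Num.min s t.
  rewrite (_ : (s + t) / (s * t) = s^-1 + t^-1); last by field; rewrite !gt_eqF.
  have [st|ts] := leP s t.
    have : t^-1 <= s^-1 by rewrite lef_pV2.
    by lra.
  have : s^-1 <= t^-1 by rewrite lef_pV2// ltW.
  by lra.
apply: le_trans (_ : m * (2 / Num.min s t) <= _); last by rewrite mulrCA.
rewrite (_ : 2^-1 * _ = cut F (fun i => i \in S) * ((s + t) / (s * t))); last by field; rewrite !gt_eqF.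
by apply: ler_pM => //; rewrite divr_ge0 ?mulr_ge0 ?addr_ge0// ltW.
Qed.

Lemma proper_set : exists S : {set 'I_n}, S != finset.set0 /\ S != [set: 'I_n]%SET.
Proof.
exists [set Ordinal (ltnW n1)]%SET; split; first by apply/set0Pn; exists (Ordinal (ltnW n1)); rewrite inE.
apply/eqP => /setP/(_ (Ordinal n1)); rewrite !inE.
by move/eqP => /(congr1 val).
Qed.

Lemma lam_tri_le : lam_tri E w pi <= 2 * dir_exp E w pi.
Proof.
rewrite mulrC -ler_pdivrMr//; apply: lb_le_inf.
  by have [S [S0 ST]] := proper_set; exists (dir_exp_set E w pi S), S.
move=> _ [S [S0 ST ->]]; rewrite ler_pdivrMr// mulrC.
have [v [fv vF]] := cut_vector S0 ST.
apply: (@le_trans _ _ (sup [set y | exists F, is_circ E w F /\ y = energy F v]%classic)).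
  apply: ge_inf; last by exists v.
  by exists 0 => _ [v' [_ ->]]; exact: sup_energy_ge0.
apply: ge_sup; first by exists (energy (fun _ _ => 0) v), (fun _ _ => 0); split => //; exact: circ0.
by move=> _ [F [cF ->]]; exact: vF.
Qed.

Lemma dir_exp_ge0 : 0 <= dir_exp E w pi.
Proof.
apply: lb_le_inf; first by have [S [S0 ST]] := proper_set; exists (dir_exp_set E w pi S), S.
move=> _ [S [_ _ ->]]; rewrite divr_ge0 ?le_min ?piS_ge0//.
by rewrite !wout_cut !cut_ge0.
Qed.

Lemma dir_exp_cut (S : {set 'I_n}) :
  dir_exp E w pi * Num.min (piS pi S) (piS pi (~: S)) <=
  Num.min (wout E w S) (wout E w (~: S)).
Proof.
have [->|S0] := eqVneq S finset.set0.
  by rewrite {1}/piS big_set0 min_l ?piS_ge0// mulr0 le_min !wout_cut !cut_ge0.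
have [->|ST] := eqVneq S [set: 'I_n]%SET.
  by rewrite finset.setCT {2}/piS big_set0 min_r ?piS_ge0// mulr0 le_min !wout_cut !cut_ge0.
rewrite -ler_pdivlMr; last by rewrite lt_min !piS_gt0// setC_neq0.
apply: ge_inf; last by exists S.
exists 0 => _ [S' [_ _ ->]]; rewrite divr_ge0 ?le_min ?piS_ge0//.
by rewrite !wout_cut !cut_ge0.
Qed.

(** * From a feasible embedding to an expansion bound *)

Section Rounding.
Variable v : 'I_n -> 'rV[R]_n.
Hypothesis fv : feasible pi v.

(** Dividing [pi] by [P] gives a probability measure, and scaling the vectors by [sqrt P] makes [d]
    equal to [P] times the squared distance. Coordinates from [n] on are set to [0]. *)
Let P := \sum_i pi i.
Let p i := pi i / P.
Let x (i : 'I_n) (k : nat) : R :=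
  if insub k is Some o then Num.sqrt P * v i ord0 o else 0.
Let d i j := dist2 n x i j.
Let phi := dir_exp E w pi.
Let lam := sup [set y | exists F, is_circ E w F /\ y = energy F v]%classic.

Let P0 : 0 < P.
Proof.
rewrite /P (bigD1 (Ordinal n1))//= ltr_pwDl//.
by apply: sumr_ge0 => j _; exact: ltW.
Qed.

Let p0 i : 0 <= p i.
Proof. by rewrite divr_ge0// ltW. Qed.

Let p1 : \sum_i p i = 1.
Proof. by rewrite -mulr_suml divff// gt_eqF. Qed.

Let dE i j : d i j = P * sqn (v i - v j).
Proof.
rewrite /d dist2C /dist2 /nsq /sqn mulr_sumr; apply: eq_bigr => k _.
rewrite /dif /x valK -mulrBr exprMn sqr_sqrtr ?(ltW P0)//.
by rewrite !mxE.
Qed.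

Let dC i j : d i j = d j i. Proof. exact: dist2C. Qed.

Let d0 i : d i i = 0. Proof. exact: dist2xx. Qed.

Let dtri i j k : d i j <= d i k + d k j.
Proof.
have [_ _ tri] := fv.
by rewrite !dE -mulrDr ler_pM2l.
Qed.

(** Expand the square around [v i]: the cross term vanishes by centring, leaving [P * sqn (v i)]
    plus the normalised variance [1]. *)
Let d_mean i : 1 <= \sum_j p j * d i j.
Proof.
have [/rowP c v1 _] := fv.
have -> : \sum_j p j * d i j = \sum_j pi j * sqn (v i - v j).
  apply: eq_bigr => j _; rewrite dE /p mulrA; congr (_ * _).
  by rewrite divfK// gt_eqF.
rewrite -v1; under eq_bigr do rewrite mulr_sumr.
under [leRHS]eq_bigr do rewrite mulr_sumr.
rewrite exchange_big [leRHS]exchange_big/=; apply: ler_sum => k _.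
have ck : \sum_j pi j * v j ord0 k = 0.
  by have := c k; rewrite summxE mxE => ck; rewrite -[RHS]ck; apply: eq_bigr => j _; rewrite mxE.
have -> : \sum_j pi j * (v i - v j) ord0 k ^+ 2 =
    P * v i ord0 k ^+ 2 - 2 * v i ord0 k * (\sum_j pi j * v j ord0 k) +
    \sum_j pi j * v j ord0 k ^+ 2.
  rewrite /P mulr_suml mulr_sumr -sumrB -big_split/=.
  by apply: eq_bigr => j _; rewrite !mxE; ring.
by rewrite ck mulr0 subr0 lerDr mulr_ge0 ?sqr_ge0// ltW.
Qed.

Let kappa := phi * P.

Let kappa0 : 0 <= kappa.
Proof. by rewrite mulr_ge0 ?dir_exp_ge0// ltW. Qed.

Let expand (A : pred 'I_n) :
  kappa * Num.min (\sum_(i | A i) p i) (\sum_(i | ~~ A i) p i) <=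
  Num.min (cut edgew A) (cut (fun i j => edgew j i) A).
Proof.
pose S : {set 'I_n} := [set i | A i]%SET.
have AE (F : 'I_n -> 'I_n -> R) : cut F (fun i => i \in S) = cut F A.
  apply: eq_big => [i|i _]; first by rewrite inE.
  by apply: eq_bigl => j; rewrite !inE.
have := dir_exp_cut S; rewrite !wout_cut cut_setC !AE; apply: le_trans.
have -> : \sum_(i | A i) p i = piS pi S / P.
  by rewrite -mulr_suml; congr (_ / _); apply: eq_bigl => i; rewrite inE.
have -> : \sum_(i | ~~ A i) p i = piS pi (~: S) / P.
  by rewrite -mulr_suml; congr (_ / _); apply: eq_bigl => i; rewrite !inE.
rewrite /kappa -mulrA ler_wpM2l ?dir_exp_ge0//.
rewrite le_min; apply/andP; split; rewrite mulrC -ler_pdivlMr// ge_min lexx ?orbT//.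
Qed.

(** The cost of a circulation for [d] is [2 P] times its energy: [2] for ordered pairs, [P] for the
    scaling. The error in the duality is arbitrarily small. *)
Let dual_bound A : (forall r : 'I_n -> R,
    A <= \sum_i \sum_j edgew i j * Num.max 0 (d i j - r i + r j)) ->
  A <= 2 * P * lam.
Proof.
move=> Ar; apply/ler_addgt0Pr => e e0.
have d_ge0 i j : 0 <= d i j by exact: nsq_ge0.
have [F|r] := @circulation_duality _ _ edgew d edgew_ge0 d_ge0 (2 * P * lam) _ _ e0; last first.
  exact: le_trans.
move=> FW FC.
have cF : is_circ E w F.
  split=> // [i j|i j nE|i j Eij]; have /andP[F1 F2] := FW i j => //.
    by apply: le_anti; rewrite F1 andbT; move: F2; rewrite /edgew (negbTE nE).
  by move: F2; rewrite /edgew Eij.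
have -> : \sum_i \sum_j F i j * d i j = 2 * P * energy F v.
  rewrite energyE mulrA [2 * P]mulrC mulfK// mulr_sumr; apply: eq_bigr => i _.
  by rewrite mulr_sumr; apply: eq_bigr => j _; rewrite dE; ring.
by rewrite ler_wpM2l ?mulr_ge0 ?(ltW P0)//; exact: energy_le_sup.
Qed.

Let from_kappa a : kappa * a <= 2 * P * lam -> phi * a <= 2 * lam.
Proof. 
rewrite /kappa (_ : phi * P * a = P * (phi * a)); last by ring.
by rewrite (_ : 2 * P * lam = P * (2 * lam)) ?ler_pM2l//; ring.
Qed.

(** The two summands of the constant serve the two cases. A heavy ball gives [3/64 * phi <= 2 lam],
    and [86 s >= 43 > 128/3]; separated sets of mass [1/80] give
    [phi * sep_const / (160^2 s) <= 2 lam]. *)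
Lemma dir_exp_le_sup : phi <=
  (86 + 2 * 160 ^+ 2 / sep_const R) * Num.sqrt (ln n%:R) * lam.
Proof.
set s := Num.sqrt _; have s2 : 2^-1 <= s := sqrt_ln_ge R n1.
have lam0 : 0 <= lam by exact: sup_energy_ge0.
have c0 := sep_const_gt0 R.
have W0 := edgew_ge0.
have exp1 : expanding p kappa edgew.
  by move=> A; apply: le_trans (expand A) _; rewrite ge_min lexx.
have exp2 : expanding p kappa (fun i j => edgew j i).
  by move=> A; apply: le_trans (expand A) _; rewrite ge_min lexx orbT.
have bnd (A B : R) : 0 <= A -> 0 <= B -> (phi <= A * s * lam \/ phi <= B * s * lam) ->
    phi <= (A + B) * s * lam.
  move=> A0 B0; rewrite mulrDl mulrDl.
  have : 0 <= A * s * lam by rewrite !mulr_ge0//; lra.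
  have : 0 <= B * s * lam by rewrite !mulr_ge0//; lra.
  by move=> ? ? []; lra.
apply: bnd => //; first by rewrite divr_ge0// ltW.
have [/existsP[i0 ball]|noball] :=
  boolP [exists i, 4^-1 <= \sum_(j | d i j <= 4^-1) p j].
  left; have : phi * (4^-1 / 2 * (3 / 4 / 2)) <= 2 * lam.
    apply: from_kappa; apply: dual_bound => r; rewrite [leLHS]mulrA.
    have := @directed_concentrated _ _ p d kappa p0 p1 d0 dC dtri kappa0 edgew r
      (* By [d_mean] the excess distance beyond the radius [1/4] averages at least [3/4], and by the
         triangle inequality it bounds from below the distance to any point of the ball. *)
      (fun j => d i0 j <= 4^-1) (fun j => Num.max 0 (d i0 j - 4^-1)) 4^-1 (3 / 4).
    apply=> //.
    - by move=> j; rewrite le_max lexx.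
    - move=> i j Ai; have := dtri i0 j i; rewrite ge_max => h.
      have d_ge0 : 0 <= d i j by exact: nsq_ge0.
      by rewrite d_ge0/=; lra.
    - apply: (@le_trans _ _ (\sum_j (p j * d i0 j - p j * 4^-1))).
        by rewrite sumrB -mulr_suml p1; have := d_mean i0; lra.
      apply: ler_sum => j _; rewrite -mulrBr ler_wpM2l//.
      by rewrite le_max lexx orbT.
  have : 2^-1 * lam <= s * lam by rewrite ler_wpM2r.
  by rewrite -mulrA; lra.
right.
(* Every ball of radius [1/4] has mass below [1/4], so each point sees mass above [3/4] outside its
   own ball. *)
have spread : 3 / 4 <= \sum_i \sum_j p i * p j * (4^-1 < d i j)%R%:R.
  rewrite -[leLHS]mul1r -[X in X * (3 / 4)]p1 mulr_suml; apply: ler_sum => i _.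
  under eq_bigr do rewrite -mulrA; rewrite -mulr_sumr ler_wpM2l//.
  have : \sum_(j | d i j <= 4^-1) p j < 4^-1.
    by rewrite ltNge; apply: contra noball => h; apply/existsP; exists i.
  have := p1; rewrite (bigID (fun j => d i j <= 4^-1))/=.
  have -> : \sum_(j | ~~ (d i j <= 4^-1)) p j = \sum_j p j * (4^-1 < d i j)%R%:R.
    rewrite big_mkcond; apply: eq_bigr => j _; rewrite -ltNge.
    by case: (_ < _); rewrite ?mulr1 ?mulr0.
  by lra.
have In : (1 < #|'I_n|)%N by rewrite card_ord.
have [L [B [pL pB LB]]] := separated_sets p0 p1 dtri spread In.
rewrite card_ord -/s in LB.
have Dl0 : 0 <= sep_const R / s by rewrite divr_ge0 ?(ltW c0)//; lra.
have : phi * (80^-1 / 2 * (80^-1 / 2 * (sep_const R / s))) <= 2 * lam.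
  apply: from_kappa; apply: dual_bound => r; rewrite [leLHS]mulrA.
  apply: (@directed_separated _ _ p d kappa p0 p1 d0 dC dtri kappa0 edgew r L B) => //.
have -> : phi * (80^-1 / 2 * (80^-1 / 2 * (sep_const R / s))) =
    phi * (sep_const R / (160 ^+ 2 * s)).
  by congr (_ * _); field; lra.
have a0 : 0 < sep_const R / (160 ^+ 2 * s).
  by rewrite divr_gt0// mulr_gt0 ?exprn_gt0//; lra.
rewrite -ler_pdivlMr// => /le_trans; apply.
rewrite le_eqVlt; apply/orP; left; apply/eqP; field.
by rewrite !gt_eqF//; lra.
Qed.

End Rounding.

Lemma dir_exp_le : dir_exp E w pi <=
  (86 + 2 * 160 ^+ 2 / sep_const R) * Num.sqrt (ln n%:R) * lam_tri E w pi.
Proof.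
have c0 := sep_const_gt0 R.
set c := _ * Num.sqrt _.
have c1 : 0 < c.
  rewrite mulr_gt0//; first by rewrite addr_gt0// divr_gt0// mulr_gt0// exprn_gt0.
  by apply: lt_le_trans (sqrt_ln_ge R n1).
rewrite mulrC -ler_pdivrMr//; apply: lb_le_inf.
  have [S [S0 ST]] := proper_set; have [v [fv _]] := cut_vector S0 ST.
  by exists (sup [set y | exists F, is_circ E w F /\ y = energy F v]%classic), v.
by move=> _ [v [fv ->]]; rewrite ler_pdivrMr// mulrC; exact: dir_exp_le_sup.
Qed.

End DirectedGraph.

Theorem mainTheorem1 : forall R : realType,
  exists c1 c2 : R, 0 < c1 /\ 0 < c2 /\
  forall (n : nat) (E : rel 'I_n) (w : 'I_n -> 'I_n -> R) (pi : 'I_n -> R),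
    (1 < n)%N ->
    (forall i j, E i j -> 0 < w i j) ->
    (forall i, 0 < pi i) ->
    lam_tri E w pi <= c1 * dir_exp E w pi /\
    dir_exp E w pi <= c2 * Num.sqrt (ln (n%:R : R)) * lam_tri E w pi.
Proof.
move=> R; exists 2, (86 + 2 * 160 ^+ 2 / sep_const R); split=> //; split.
  have c0 := sep_const_gt0 R.
  by rewrite addr_gt0// divr_gt0// mulr_gt0// exprn_gt0.
move=> n E w pi n1 w0 pi0; split; first exact: lam_tri_le.
exact: dir_exp_le.
Qed.
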